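(* Let $g\in\mathbb{N}_0$, and let $\mathcal{A}\subset C(\mathbb{T}_{g,q})$, $\mathcal{H}=\ell_2(\mathbb{N})\oplus\ell_2(\mathbb{N})$, $\pi$, $D$ and $S$ be as defined in the context. Consider the finitely generated left $\mathcal{A}$-module $\mathcal{A}(1-SS^* )\subset B(\ell_2(\mathbb{N}))$ together with the sesquilinear form $$\langle\langle b,a\rangle\rangle:=\langle e_0,b^*a\,e_0\rangle=\langle be_0,ae_0\rangle,\qquad a,b\in\mathcal{A}(1-SS^* ).$$ Then the left $\mathcal{A}$-modules $\mathcal{H}_\infty:=\bigcap_{n\in\mathbb{N}}\mathrm{dom}(D^n)$ and $\mathcal{A}(1-SS^* )\oplus\mathcal{A}(1-SS^* )$ are isometrically isomorphic.
   Context: Toeplitz algebra: Let $u(\mathrm{e}^{\mathrm{i}t})=\mathrm{e}^{\mathrm{i}t}$ be the unitary generator of $C(\mathbb{S}^1)\subset L_2(\mathbb{S}^1)$, and let $e_k=\frac{1}{\sqrt{2\pi}}u^k$, $k\in\mathbb{Z}$, be the standard orthonormal basis of $L_2(\mathbb{S}^1)$. Let $\ell_2(\mathbb{N}):=\overline{\mathrm{span}}\{e_n:n\in\mathbb{N}_0\}$ and let $P$ be the orthogonal projection from $L_2(\mathbb{S}^1)$ onto $\ell_2(\mathbb{N})$. For $f\in C(\mathbb{S}^1)$ define $T_f\in B(\ell_2(\mathbb{N}))$ by $T_f(\phi)=P(f\phi)$. The Toeplitz algebra $\mathcal{T}\subset B(\ell_2(\mathbb{N}))$ is the C*-algebra generated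 by all $T_f$, $f\in C(\mathbb{S}^1)$. It contains the compact operators $K(\ell_2(\mathbb{N}))$, and the symbol map $\sigma:\mathcal{T}\to C(\mathbb{S}^1)$ is the surjective $*$-homomorphism with kernel $K(\ell_2(\mathbb{N}))$ determined by $\sigma(T_f)=f$. Quantum surfaces: For $g\geq 1$ and $k=1,\ldots,2g$ define arcs $a_k,a_k^{-1}:[0,1]\to\mathbb{S}^1$ by $a_k(t)=\mathrm{e}^{\pi\mathrm{i}\frac{k-1+t}{2g}}$ and $a_k^{-1}(t)=\mathrm{e}^{\pi\mathrm{i}\frac{2g+k-t}{2g}}$. For $g=0$ use instead the single pair $a_0(t)=\mathrm{e}^{\pi\mathrm{i}t}$, $a_0^{-1}(t)=\mathrm{e}^{-\pi\mathrm{i}t}$. Let $C_g$ be the C*-algebra of all $f\in C(\mathbb{S}^1)$ such that $f(a_k(t))=f(a_k^{-1}(t))$ for all $t\in[0,1]$ and all $k=1,\ldots,2g$ (only $k=0$ if $g=0$). Define $C(\mathbb{T}_{g,q}):=\{x\in\mathcal{T}:\sigma(x)\in C_g\}$, a C*-subalgebra of $\mathcal{T}$. The algebra $\mathcal{A}$: Let $\mathcal{K}_S\subset K(\ell_2(\mathbb{N}))$ be the set of matrices of rapid decay, i.e. operators $A$ with $Ae_n=\sum_{k\in\mathbb{N}_0}a_{kn}e_k$ such that $\lim_{k+n\to\infty}|k^\alpha a_{kn}n^\beta|=0$ for all $\alpha,\beta\in\mathbb{N}_0$ (with $0^0=1$). Let $\mathcal{A}$ be the $*$-algebra generated by $\mathcal{K}_S$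 and $\{T_f: f\in C^\infty(\mathbb{S}^1)\cap C_g\}$. Representation and Dirac operator: $\mathcal{H}:=\ell_2(\mathbb{N})\oplus\ell_2(\mathbb{N})$ and $\pi(a)(v_+\oplus v_-):=av_+\oplus av_-$. Let $S\in B(\ell_2(\mathbb{N}))$ be the shift $Se_k=e_{k+1}$, $k\in\mathbb{N}_0$; thus $1-SS^*\in\mathcal{K}_S\subset\mathcal{A}$ is the orthogonal projection onto $\mathbb{C}e_0$. Let $N$ be the self-adjoint number operator $Ne_n=ne_n$ with $\mathrm{dom}(N)=\{\sum_n\alpha_ne_n\in\ell_2(\mathbb{N}):\sum_n n^2|\alpha_n|^2<\infty\}$. Define $D:=\begin{pmatrix}0&S^*N\\ NS&0\end{pmatrix}$ with $\mathrm{dom}(D)=\mathrm{dom}(N)\oplus\mathrm{dom}(N)$. Conventions: $\mathcal{A}(1-SS^* )=\{a(1-SS^* ):a\in\mathcal{A}\}$ is a left $\mathcal{A}$-module by multiplication; the direct sum $\mathcal{A}(1-SS^* )\oplus\mathcal{A}(1-SS^* )$ carries the diagonal action and the sum of the two sesquilinear forms. $\mathcal{H}_\infty$ carries the action of $\mathcal{A}$ via $\pi$ and the inner product of $\mathcal{H}$. ''Isometrically isomorphic'' means that there is a bijective $\mathcal{A}$-linear map preserving these forms. Inner products are conjugate-linear in the first argument. *)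

(* Defs.v *)
From HB Require Import structures.
From mathcomp Require Import all_boot all_order all_algebra.
From mathcomp Require Import generic_quotient ring_quotient.
From mathcomp Require Import complex.
From mathcomp Require Import all_classical all_reals all_analysis.
From mathcomp Require Import measurable_realfun.
From mathcomp Require Import ring lra.

Set Implicit Arguments.
Unset Strict Implicit.
Unset Printing Implicit Defensive.

Import Order.TTheory GRing.Theory Num.Theory.
Import numFieldNormedType.Exports.

Local Open Scope classical_set_scope.
Local Open Scope ring_scope.
Local Open Scope complex_scope.

Section L2.
Context (R : realType).
Local Notation C := R[i].
Local Notation Re := (@complex.Re R).
Local Notation Im := (@complex.Im R).

Lemma lebesgue_circle_fin :
  (@lebesgue_measure R `[0%R, (2 * pi)%R]%classic < +oo)%E.
Proof. by rewrite lebesgue_measure_itv /=; case: ifPn => _; rewrite ltry. Qed.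

Definition mu_circle : {finite_measure set (measurableTypeR R) -> \bar R} :=
  @mfrestr _ (measurableTypeR R) R _ lebesgue_measure
    (measurable_itv `[0, 2 * pi]) lebesgue_circle_fin.

(* Square-integrable complex functions of the angle t in [0, 2 pi]. *)
Definition sqint : {pred R -> C} :=
  [pred f : R -> C | ((Re \o f) \in Lfun mu_circle 2%:E) &&
                     ((Im \o f) \in Lfun mu_circle 2%:E)].

Lemma L2fun_submod_closed : submod_closed (Lfun mu_circle 2%:E).
Proof. by apply: Lfun_submod_closed; rewrite lee_fin ler1n. Qed.

Lemma L2funD (f h : R -> R) :
  f \in Lfun mu_circle 2%:E -> h \in Lfun mu_circle 2%:E ->
  (fun t => f t + h t) \in Lfun mu_circle 2%:E.
Proof.
have [_ VL] := L2fun_submod_closed.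
by move=> fV hV; have := VL 1 f h fV hV; rewrite scale1r.
Qed.

Lemma L2funZ (a : R) (f : R -> R) :
  f \in Lfun mu_circle 2%:E -> (fun t => a * f t) \in Lfun mu_circle 2%:E.
Proof.
have [V0 VL] := L2fun_submod_closed.
by move=> fV; have := VL a f 0 fV V0; rewrite addr0.
Qed.

Lemma sqint_submod_closed : submod_closed sqint.
Proof.
have [V0 _] := L2fun_submod_closed.
split; first by rewrite inE; apply/andP; split; exact: V0.
move=> a f h /andP[fR fI] /andP[hR hI]; rewrite inE; apply/andP; split.
- rewrite [X in X \in _](_ : _ = fun t => (complex.Re a * complex.Re (f t) +
     (- complex.Im a) * complex.Im (f t)) + complex.Re (h t)).
    by apply: L2funD hR; apply: L2funD; [exact: L2funZ fR | exact: L2funZ fI].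
  apply/funext => t /=.
  by rewrite !fctE; case: a (f t) (h t) => [a1 a2] [? ?] [? ?] /=; rewrite mulNr.
- rewrite [X in X \in _](_ : _ = fun t => (complex.Re a * complex.Im (f t) +
     complex.Im a * complex.Re (f t)) + complex.Im (h t)).
    by apply: L2funD hI; apply: L2funD; [exact: L2funZ fI | exact: L2funZ fR].
  apply/funext => t /=.
  by rewrite !fctE; case: a (f t) (h t) => [a1 a2] [? ?] [? ?] /=.
Qed.

HB.instance Definition _ :=
  GRing.isSubmodClosed.Build C (R -> C) sqint sqint_submod_closed.

Record sqfun := Sqfun { sqfun_val :> R -> C; _ : sqfun_val \in sqint }.

HB.instance Definition _ := [isSub for sqfun_val].
HB.instance Definition _ := [Choice of sqfun by <:].
HB.instance Definition _ := [SubChoice_isSubLmodule of sqfun by <:].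

Lemma sqfunDE (f h : sqfun) t : (f + h) t = f t + h t. Proof. by []. Qed.

Lemma sqfunBE (f h : sqfun) t : (f - h) t = f t - h t. Proof. by []. Qed.

Lemma sqfunZE a (f : sqfun) t : (a *: f) t = a * f t. Proof. by []. Qed.

Definition nullfun : {pred sqfun} :=
  [pred f : sqfun | `[< {ae mu_circle, forall t, f t = 0} >]].

Lemma nullP (f : sqfun) :
  f \in nullfun <-> {ae mu_circle, forall t, f t = 0}.
Proof. by split=> /asboolP. Qed.

Lemma ae_circle_filter : Filter (nbhs (almost_everywhere mu_circle)).
Proof. exact: (ae_filter_ringOfSetsType mu_circle). Qed.

Lemma null_submod_closed : submod_closed nullfun.
Proof.
have FF := ae_circle_filter.
split; first by apply/nullP; exact: (aeW mu_circle).
move=> a f h /nullP f0 /nullP h0; apply/nullP; near=> t.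
by rewrite sqfunDE sqfunZE (near f0 t) // (near h0 t) // mulr0 addr0.
Unshelve. all: by end_near.
Qed.

HB.instance Definition _ :=
  GRing.isSubmodClosed.Build C sqfun nullfun null_submod_closed.

(* L_2 of the circle: square-integrable functions modulo a.e. equality, with
   respect to the (unnormalised) angle measure dt on [0, 2 pi]. *)
Definition L2 : Type := Quotient.quot nullfun.
HB.instance Definition _ := GRing.Zmodule.on L2.
HB.instance Definition _ := ZmodQuotient.on L2.

Local Open Scope quotient_scope.

Lemma L2_eqP (f h : sqfun) :
  \pi_L2 f = \pi_L2 h <-> {ae mu_circle, forall t, f t = h t}.
Proof.
have FF := ae_circle_filter.
split=> [/eqP|fh].
  rewrite -Quotient.idealrBE => /nullP fh; near=> t.
  by apply/eqP; rewrite -subr_eq0 -sqfunBE (near fh t).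
apply/eqP; rewrite -Quotient.idealrBE; apply/nullP; near=> t.
by rewrite sqfunBE (near fh t) // subrr.
Unshelve. all: by end_near.
Qed.

Definition scaleL2 (a : C) (x : L2) : L2 := \pi_L2 (a *: repr x).

Lemma pi_scaleL2 a (f : sqfun) : scaleL2 a (\pi_L2 f) = \pi_L2 (a *: f).
Proof.
apply/eqP; rewrite -Quotient.idealrBE -scalerBr rpredZ //.
by rewrite Quotient.idealrBE reprK.
Qed.

Lemma scaleL2A a b x : scaleL2 a (scaleL2 b x) = scaleL2 (a * b) x.
Proof.
rewrite -[x]reprK (pi_scaleL2 b) (pi_scaleL2 a) (pi_scaleL2 (a * b)).
by rewrite scalerA.
Qed.

Lemma scaleL21 : left_id 1 scaleL2.
Proof. by move=> x; rewrite -[x]reprK (pi_scaleL2 1) scale1r. Qed.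

Lemma scaleL2Dr : right_distributive scaleL2 +%R.
Proof.
move=> a x y; rewrite -[x]reprK -[y]reprK !(pi_scaleL2 a).
by rewrite -!(raddfD \pi_L2) /= (pi_scaleL2 a) scalerDr.
Qed.

Lemma scaleL2Dl x : {morph scaleL2^~ x : a b / a + b}.
Proof.
move=> a b; rewrite -[x]reprK (pi_scaleL2 a) (pi_scaleL2 b).
by rewrite (pi_scaleL2 (a + b)) -(raddfD \pi_L2) /= scalerDl.
Qed.

HB.instance Definition _ := GRing.Zmodule_isLmodule.Build C L2
  scaleL2A scaleL21 scaleL2Dr scaleL2Dl.

Lemma piZ (a : C) (f : sqfun) : a *: (\pi_L2 f : L2) = \pi_L2 (a *: f).
Proof. exact: pi_scaleL2. Qed.

Lemma piD (f h : sqfun) : (\pi_L2 f : L2) + (\pi_L2 h : L2) = \pi_L2 (f + h).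
Proof. by rewrite -(raddfD \pi_L2). Qed.

Definition cintegral (f : R -> C) : C :=
  (\int[mu_circle]_t Re (f t)) +i* (\int[mu_circle]_t Im (f t)).

(* Conjugate-linear in the first argument. *)
Definition innerL2 (x y : L2) : C :=
  cintegral (fun t => conjc (repr x t) * repr y t).

Definition normL2 (x : L2) : R := Num.sqrt (Re (innerL2 x x)).

Definition normsq (z : C) : R := complex.Re z ^+ 2 + complex.Im z ^+ 2.

Lemma normsq_integrable (f : sqfun) :
  mu_circle.-integrable setT (EFin \o (fun t => normsq (f t))).
Proof.
have /andP[fR fI] := valP f.
have iR := Lfun2_integrable_sqr fR; have iI := Lfun2_integrable_sqr fI.
by apply: eq_integrable (integrableD measurableT iR iI) => // t _.
Qed.

Lemma sqnormE (f : sqfun) :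
  Re (innerL2 (\pi_L2 f) (\pi_L2 f)) = \int[mu_circle]_t normsq (f t).
Proof.
have fE : {ae mu_circle, forall t, repr (\pi_L2 f) t = f t}.
  by apply/L2_eqP; rewrite reprK.
have FF := ae_circle_filter.
rewrite /innerL2 /cintegral /= /Rintegral; congr fine.
have H (h : sqfun) t : complex.Re (conjc (h t) * h t) = normsq (h t).
  by rewrite /normsq; case: (h t) => x y /=; rewrite mulNr opprK !expr2.
under eq_integral => t _ do rewrite H.
apply: ae_eq_integral => //.
- by have /measurable_int := normsq_integrable (repr (\pi_L2 f)).
- by have /measurable_int := normsq_integrable f.
- by near=> t; move=> _; rewrite (near fE t).
Unshelve. all: by end_near.
Qed.

Lemma sqnorm_ge0 (x : L2) : 0 <= Re (innerL2 x x).
Proof.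
rewrite -[x]reprK sqnormE; apply: Rintegral_ge0 => // t _.
by rewrite addr_ge0 // sqr_ge0.
Qed.

Lemma sqnormZ a (x : L2) :
  Re (innerL2 (a *: x) (a *: x)) = normsq a * Re (innerL2 x x).
Proof.
rewrite -[x]reprK piZ !sqnormE.
rewrite -RintegralZl //; last exact: normsq_integrable.
apply: eq_Rintegral => t _; rewrite sqfunZE.
by rewrite /normsq; case: a (repr x t) => a b [c d] /=; ring.
Qed.

Lemma sqnormD (x y : L2) :
  Re (innerL2 (x + y) (x + y)) <= 2 * (Re (innerL2 x x) + Re (innerL2 y y)).
Proof.
rewrite -[x]reprK -[y]reprK piD !sqnormE.
have ix := normsq_integrable (repr x); have iy := normsq_integrable (repr y).
rewrite -RintegralD // -RintegralZl //; last first.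
  by apply: eq_integrable (integrableD measurableT ix iy) => // t _.
apply: le_Rintegral => //.
- exact: normsq_integrable.
- have := integrableZl measurableT 2 (integrableD measurableT ix iy).
  by apply: eq_integrable => // t _.
move=> t _; rewrite sqfunDE /normsq.
case: (repr x t) (repr y t) => [a b] [c d] /=.
by have := sqr_ge0 (a - c); have := sqr_ge0 (b - d); nra.
Qed.

Lemma normL20 : normL2 0 = 0.
Proof.
by rewrite /normL2 -(scale0r 0) sqnormZ /normsq /= expr0n addr0 mul0r sqrtr0.
Qed.

Lemma normL2_lt (x : L2) (eps : R) :
  0 < eps -> (normL2 x < eps) = (Re (innerL2 x x) < eps ^+ 2).
Proof.
move=> eps0; rewrite /normL2 -[in RHS](sqr_sqrtr (sqnorm_ge0 x)).
by rewrite ltr_pXn2r // nnegrE ?sqrtr_ge0 // ltW.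
Qed.

Lemma Lfun2_bounded_mul (M : R) (h f : R -> R) :
  measurable_fun setT h -> (forall t, 0 <= t <= 2 * pi -> `|h t| <= M) ->
  f \in Lfun mu_circle 2%:E -> (fun t => h t * f t) \in Lfun mu_circle 2%:E.
Proof.
move=> mh hM fV; have := L2funZ M fV.
have mf : measurable_fun setT f by move: fV => /andP[]; rewrite inE.
move=> /andP[_ /[!inE] /= MV]; apply/andP; split; rewrite inE /=.
  exact: (measurable_funM mh mf).
have mP (k : R -> R) : measurable_fun setT k ->
    measurable_fun setT (fun t => `|k t| `^ 2).
  move=> mk; apply: (measurableT_comp (measurable_powR 2)).
  exact: (measurableT_comp _ mk).
apply: le_lt_trans MV.
rewrite unlock /=; apply: gt0_ler_poweR => //.
- by rewrite in_itv /= leey integral_ge0 // => t _; exact: poweR_ge0.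
- by rewrite in_itv /= leey integral_ge0 // => t _; exact: poweR_ge0.
apply: ae_ge0_le_integral => //.
- by apply/measurable_EFinP; apply: mP; exact: (measurable_funM mh mf).
- apply/measurable_EFinP; apply: mP.
  exact: (measurable_funM (measurable_cst M) mf).
exists (~` `[0, 2 * pi]); split.
- exact: measurableC.
- by rewrite /mu_circle /= /mfrestr /mrestr setICl measure0.
apply: subsetC => t /=; rewrite in_itv /= => t2pi _.
rewrite lee_fin ge0_ler_powR // ?nnegrE //.
by rewrite !normrM ler_pM // (le_trans (hM t t2pi)) // ler_norm.
Qed.

Definition cis (t : R) : C := cos t +i* sin t.

Lemma sqint_cisM (f : R -> C) : f \in sqint -> (fun t => cis t * f t) \in sqint.
Proof.
have mc : measurable_fun setT (@cos R).
  by apply: continuous_measurable_fun; exact: continuous_cos.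
have ms : measurable_fun setT (@sin R).
  by apply: continuous_measurable_fun; exact: continuous_sin.
move=> /andP[fR fI].
have Vc (h : R -> R) : h \in Lfun mu_circle 2%:E -> (fun t => cos t * h t) \in Lfun mu_circle 2%:E.
  by apply: (@Lfun2_bounded_mul 1) => // t; rewrite ler_norml cos_geN1 cos_le1.
have Vs (h : R -> R) : h \in Lfun mu_circle 2%:E -> (fun t => sin t * h t) \in Lfun mu_circle 2%:E.
  by apply: (@Lfun2_bounded_mul 1) => // t; rewrite ler_norml sin_geN1 sin_le1.
rewrite inE; apply/andP; split.
- rewrite [X in X \in _](_ : _ = fun t => cos t * Re (f t) + -1 * (sin t * Im (f t))).
    by apply: L2funD; [exact: Vc fR | exact: L2funZ (Vs _ fI)].
  by apply/funext => t /=; case: (f t) => x y /=; rewrite mulN1r.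
- rewrite [X in X \in _](_ : _ = fun t => cos t * Im (f t) + sin t * Re (f t)).
    by apply: L2funD; [exact: Vc fI | exact: Vs fR].
  by apply/funext => t /=; case: (f t).
Qed.

Lemma fourier_sqint (n : nat) :
  (fun t => cis t ^+ n / (Num.sqrt (2 * pi))%:C) \in sqint.
Proof.
elim: n => [|n IH].
  by rewrite inE; apply/andP; split; exact: (Lfun_cst mu_circle).
by under eq_fun do rewrite exprS -mulrA; exact: sqint_cisM.
Qed.

(* u^n / sqrt (2 pi), the n-th vector of the standard orthonormal basis. *)
Definition fourier (n : nat) : L2 := \pi_L2 (Sqfun (fourier_sqint n)).

(* The closed linear span of the vectors [fourier n], n >= 0; the finite linear
   combinations are indexed by lists of pairs (coefficient, index). *)
Definition hardy : {pred L2} := [pred x | `[< forall eps : R, 0 < eps ->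
  exists s : seq (C * nat),
    normL2 (x - \sum_(p <- s) p.1 *: fourier p.2) < eps >]].

Lemma hardy_submod_closed : submod_closed hardy.
Proof.
split.
  apply/asboolP => eps eps0; exists [::]; rewrite big_nil subr0.
  by rewrite normL20.
move=> a x y /asboolP hx /asboolP hy; apply/asboolP => eps eps0.
set A := normsq a.
have A0 : 0 <= A by rewrite addr_ge0 // sqr_ge0.
have B0 : 0 < 2 * (A + 1) by lra.
have [s hs] := hx (eps / (2 * (A + 1))) (divr_gt0 eps0 B0).
have [s' hs'] := hy (eps / 2) (divr_gt0 eps0 (ltr0Sn _ _)).
exists ([seq (a * p.1, p.2) | p <- s] ++ s').
rewrite big_cat big_map /=.
under eq_bigr do rewrite -scalerA.
rewrite -scaler_sumr opprD addrACA -scalerBr.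
move: hs hs'; rewrite !normL2_lt ?divr_gt0 //.
set x' := x - _; set y' := y - _ => hs hs'.
apply: le_lt_trans (sqnormD _ _) _; rewrite sqnormZ -/A.
have : A * complex.Re (innerL2 x' x') <= eps ^+ 2 / 4.
  apply: (le_trans (ler_wpM2l A0 (ltW hs))).
  have -> : A * (eps / (2 * (A + 1))) ^+ 2 =
    (eps ^+ 2 / 4) * (A / (A + 1) ^+ 2) by field; lra.
  rewrite ler_piMr ?divr_ge0 ?sqr_ge0 // ler_pdivrMr ?exprn_gt0 //; nra.
have E4 : (eps / 2) ^+ 2 = eps ^+ 2 / 4 by field.
by move: hs'; rewrite E4; lra.
Qed.

HB.instance Definition _ :=
  GRing.isSubmodClosed.Build C L2 hardy hardy_submod_closed.

Record ell2 := Ell2 { ell2_val :> L2; _ : ell2_val \in hardy }.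

HB.instance Definition _ := [isSub for ell2_val].
HB.instance Definition _ := [Choice of ell2 by <:].
HB.instance Definition _ := [SubChoice_isSubLmodule of ell2 by <:].

Lemma fourier_hardy n : fourier n \in hardy.
Proof.
apply/asboolP => eps eps0; exists [:: (1, n)].
rewrite big_seq1 /= scale1r subrr.
by rewrite normL20.
Qed.

Definition ebasis (n : nat) : ell2 := Ell2 (fourier_hardy n).

Definition inner_ell2 (x y : ell2) : C := innerL2 x y.

Definition norm2 (x : ell2) : R := normL2 x.

(* Functions on the circle are represented by functions on C; only their values
   on [circle] matter. *)
Definition circle : set C^o := [set z | `|z| = 1].

Definition continuous_circle (f : C -> C) : Prop :=
  {within circle, continuous (f : C^o -> C^o)}.

(* t |-> f (exp (i t)) is infinitely differentiable. *)
Definition smooth_circle (f : C -> C) : Prop := forall n t,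
  derivable (derive1n n (fun s => Re (f (cis s)))) t 1 /\
  derivable (derive1n n (fun s => Im (f (cis s)))) t 1.

Lemma cis_circle t : circle (cis t).
Proof. by rewrite /circle /= normc_def /= cos2Dsin2 sqrtr1. Qed.

Lemma continuous_real_complex : continuous (fun x : R => (x%:C : C^o)).
Proof.
move=> x; apply/cvgrPdist_lt => eps eps0; apply/nbhs_ballP.
have epsE : eps = (Re eps)%:C by rewrite RRe_real // gtr0_real.
exists (Re eps); first by move: eps0; rewrite /= epsE ltcR.
move=> y xy; rewrite epsE -rmorphB normc_def /= expr0n addr0 sqrtr_sqr ltcR.
exact: xy.
Qed.

Lemma continuous_cis : continuous (cis : R -> C^o).
Proof.
move=> t.
have -> : (cis : R -> C^o) = fun t => (cos t)%:C + 'i%C * (sin t)%:C :> C^o.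
  by apply/funext => u; rewrite [LHS]complexE.
apply: (@cvgD _ C^o).
  exact: (continuous_comp (@continuous_cos R t) (@continuous_real_complex _)).
apply: (@cvgM C); first exact: cvg_cst.
exact: (continuous_comp (@continuous_sin R t) (@continuous_real_complex _)).
Qed.

Lemma continuous_Re : continuous (Re : C^o -> R).
Proof.
move=> x U /nbhs_ballP[eps eps0 epsU]; apply/(@nbhs_ballP _ C^o).
exists eps%:C; first by rewrite /= ltcR.
move=> y /(le_lt_trans (normc_ge_Re _)); rewrite ltcR => xy; apply: epsU.
by case: x y xy => [? ?] [? ?].
Qed.

Lemma normc_ge_Im (z : C) : `|Im z|%:C <= `|z|.
Proof.
by rewrite normc_def lecR -sqrtr_sqr ler_wsqrtr // lerDr sqr_ge0.
Qed.

Lemma continuous_Im : continuous (Im : C^o -> R).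
Proof.
move=> x U /nbhs_ballP[eps eps0 epsU]; apply/(@nbhs_ballP _ C^o).
exists eps%:C; first by rewrite /= ltcR.
move=> y /(le_lt_trans (normc_ge_Im _)); rewrite ltcR => xy; apply: epsU.
by case: x y xy => [? ?] [? ?].
Qed.

Lemma continuous_symbol (f : C -> C) : continuous_circle f ->
  continuous (fun t => f (cis t) : C^o).
Proof.
move=> fc t U /(fc (cis t)) fU.
have {}fU : within circle (nbhs (cis t : C^o)) (f @^-1` U).
  by rewrite nbhs_subspace_in //; exact: cis_circle.
have := continuous_cis fU.
rewrite !nbhs_filterE; apply: (@filterS _ (nbhs (t : R^o))) => u fu.
exact/fu/cis_circle.
Qed.

Lemma bounded_2pi (h : R -> R) : continuous h ->
  exists M, forall t, 0 <= t <= 2 * pi -> `|h t| <= M.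
Proof.
move=> hc; have pi2 : 0 <= 2 * pi :> R by rewrite mulr_ge0 // pi_ge0.
have [|c _ cM] := @EVT_max R (fun t => `|h t|) 0 (2 * pi) pi2.
  apply: continuous_subspaceT => t; exact: (continuous_comp (hc t) (@norm_continuous _ _ _)).
by exists `|h c| => t t2; apply: cM; rewrite in_itv.
Qed.

Lemma mul_sqint (f : C -> C) (x : sqfun) : continuous_circle f ->
  (fun t => f (cis t) * x t) \in sqint.
Proof.
move=> fc; have fcis := continuous_symbol fc.
have cR : continuous (fun t => Re (f (cis t))).
  by move=> t; exact: (continuous_comp (fcis t) (@continuous_Re _)).
have cI : continuous (fun t => Im (f (cis t))).
  by move=> t; exact: (continuous_comp (fcis t) (@continuous_Im _)).
have [MR hR] := bounded_2pi cR; have [MI hI] := bounded_2pi cI.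
have mR := continuous_measurable_fun cR; have mI := continuous_measurable_fun cI.
have /andP[xR xI] := valP x.
rewrite inE; apply/andP; split.
- rewrite [X in X \in _](_ : _ = fun t => Re (f (cis t)) * Re (x t) +
     -1 * (Im (f (cis t)) * Im (x t))).
    apply: L2funD; first exact: Lfun2_bounded_mul mR hR xR.
    exact: L2funZ (Lfun2_bounded_mul mI hI xI).
  apply/funext => t /=.
  by case: (f _) (x t) => [? ?] [? ?] /=; rewrite mulN1r.
- rewrite [X in X \in _](_ : _ = fun t => Re (f (cis t)) * Im (x t) +
     Im (f (cis t)) * Re (x t)).
    apply: L2funD; first exact: Lfun2_bounded_mul mR hR xI.
    exact: Lfun2_bounded_mul mI hI xR.
  apply/funext => t /=.
  by case: (f _) (x t) => [? ?] [? ?] /=.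
Qed.

(* The class of f x; for f continuous on the circle the default value of
   [insubd] is not used, by [mul_sqint]. *)
Definition mulL2 (f : C -> C) (x : L2) : L2 :=
  \pi_L2 (insubd (0 : sqfun) (fun t => f (cis t) * repr x t)).

(* Orthogonal projection of L2 onto the closed subspace ell2: the vector y of
   ell2 such that x - y is orthogonal to ell2; it exists and is unique. *)
Definition projH (x : L2) : ell2 :=
  xget 0 [set y : ell2 | forall z : ell2, innerL2 z (x - ell2_val y) = 0].

Definition operator : Type := ell2 -> ell2.

Definition toeplitz (f : C -> C) : operator := fun x => projH (mulL2 f x).

Definition bounded_op (A : operator) : Prop :=
  linear A /\ exists M : R, forall x, norm2 (A x) <= M * norm2 x.

(* Hilbert space adjoint; it exists, and is unique, for every bounded A. *)
Definition adjoint (A : operator) : operator :=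
  xget 0 [set B : operator |
    forall x y, inner_ell2 (A x) y = inner_ell2 x (B y)].

(* The labels k of the arcs a_k, and the arcs a_k and a_k^-1. *)
Definition arc_index (g k : nat) : bool :=
  if g == 0%N then k == 0%N else (1 <= k <= 2 * g)%N.

Definition arc_pos (g k : nat) (t : R) : C :=
  if g == 0%N then cis (pi * t)
  else cis (pi * ((k%:R - 1 + t) / (2 * g)%N%:R)).

Definition arc_neg (g k : nat) (t : R) : C :=
  if g == 0%N then cis (- (pi * t))
  else cis (pi * (((2 * g)%N%:R + k%:R - t) / (2 * g)%N%:R)).

Definition C_surface (g : nat) (f : C -> C) : Prop :=
  continuous_circle f /\
  forall k, arc_index g k -> forall t, 0 <= t <= 1 ->
    f (arc_pos g k t) = f (arc_neg g k t).

(* The matrix entries are a_(k,n) = <e_k, A e_n>, and 0 ^+ 0 = 1. *)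
Definition rapid_decay (A : operator) : Prop :=
  forall (alpha beta : nat) (eps : R),
  0 < eps -> exists m : nat, forall k n : nat, (m <= k + n)%N ->
  `|k%:R ^+ alpha * inner_ell2 (ebasis k) (A (ebasis n)) * n%:R ^+ beta| < eps%:C.

(* Bounded operators with such a matrix are Hilbert-Schmidt, hence compact. *)
Definition K_S : set operator := [set A | bounded_op A /\ rapid_decay A].

Inductive star_algebra (G : set operator) : set operator :=
| Star_gen A : G A -> star_algebra G A
| Star_add A B : star_algebra G A -> star_algebra G B -> star_algebra G (A + B)
| Star_scale (c : C) A : star_algebra G A -> star_algebra G (c *: A)
| Star_mul A B : star_algebra G A -> star_algebra G B -> star_algebra G (A \o B)
| Star_adj A : star_algebra G A -> star_algebra G (adjoint A).

Definition algA (g : nat) : set operator := star_algebra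
  (K_S `|` [set toeplitz f | f in [set f | smooth_circle f /\ C_surface g f]]).

Definition is_shift (S : operator) : Prop :=
  bounded_op S /\ forall k, S (ebasis k) = ebasis k.+1.

(* The coordinates of v are alpha_n = <e_n, v>. *)
Definition dom_number : set ell2 := [set v |
  (\sum_(0 <= n <oo) (n%:R ^+ 2 * normsq (inner_ell2 (ebasis n) v))%:E < +oo)%E].

(* Unbounded operators are given by their graphs: [number_op v w] means that v
   is in dom N and w = N v, i.e. w = sum_n n alpha_n e_n. *)
Definition number_op (v w : ell2) : Prop :=
  dom_number v /\
  forall n, inner_ell2 (ebasis n) w = n%:R * inner_ell2 (ebasis n) v.

Definition hilb : Type := (ell2 * ell2)%type.

Definition innerH (v w : hilb) : C := inner_ell2 v.1 w.1 + inner_ell2 v.2 w.2.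

Definition repH (a : operator) (v : hilb) : hilb := (a v.1, a v.2).

(* The graph of D, D (v+, v-) = (S^* N v-, N S v+), on dom N x dom N. *)
Definition dirac_op (S : operator) (v w : hilb) : Prop :=
  [/\ dom_number v.1, dom_number v.2,
      exists2 x, number_op v.2 x & w.1 = adjoint S x
    & number_op (S v.1) w.2].

(* T^n for operators given by their graphs: dom T^(n+1) consists of the v in
   dom T with T v in dom T^n. *)
Fixpoint graph_pow (T : hilb -> hilb -> Prop) (n : nat) (v w : hilb) : Prop :=
  if n is m.+1 then exists2 u, T v u & graph_pow T m u w else v = w.

Definition H_infty (S : operator) : set hilb :=
  [set v | forall n : nat, exists w, graph_pow (dirac_op S) n v w].

(* 1 - S S^* *)
Definition proj0 (S : operator) : operator := fun x => x - S (adjoint S x).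

Definition cyclic_module (g : nat) (S : operator) : set operator :=
  [set a \o proj0 S | a in algA g].

Definition mod_form (b a : operator) : C :=
  inner_ell2 (ebasis 0) ((adjoint b \o a) (ebasis 0)).

Definition mod_form2 (b a : operator * operator) : C :=
  mod_form b.1 a.1 + mod_form b.2 a.2.

Definition act1 (a x : operator) : operator := a \o x.

Definition act2 (a : operator) (x : operator * operator) : operator * operator :=
  (a \o x.1, a \o x.2).

Definition left_module (V : lmodType C) (A : set operator)
    (act : operator -> V -> V) (M : set V) : Prop :=
  [/\ M 0 /\ (forall v w, M v -> M w -> M (v + w)),
      forall a v, A a -> M v -> M (act a v),
      forall a v w, A a -> M v -> M w -> act a (v + w) = act a v + act a w,
      forall a b v, A a -> A b -> M v -> act (a + b) v = act a v + act b v
    & forall a b v, A a -> A b -> M v -> act (a \o b) v = act a (act b v)].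

Definition finitely_generated (V : lmodType C) (A : set operator)
    (act : operator -> V -> V) (M : set V) : Prop :=
  exists (n : nat) (m : 'I_n -> V), (forall i, M (m i)) /\
  forall v, M v -> exists a : 'I_n -> operator,
    (forall i, A (a i)) /\ v = \sum_i act (a i) (m i).

Definition isometrically_isomorphic (V W : lmodType C) (A : set operator)
    (actV : operator -> V -> V) (formV : V -> V -> C) (MV : set V)
    (actW : operator -> W -> W) (formW : W -> W -> C) (MW : set W) : Prop :=
  exists Phi : V -> W,
  [/\ set_bij MV MW Phi,
      forall v w, MV v -> MV w -> Phi (v + w) = Phi v + Phi w,
      forall a v, A a -> MV v -> Phi (actV a v) = actW a (Phi v)
    & forall v w, MV v -> MV w -> formW (Phi v) (Phi w) = formV v w].

End L2.

(* Main.v *)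
Require Import Defs.
From mathcomp Require Import all_boot all_order all_algebra.
From mathcomp Require Import generic_quotient ring_quotient.
From mathcomp Require Import complex.
From mathcomp Require Import all_classical all_reals all_analysis.
From mathcomp Require Import measurable_realfun.
From mathcomp Require Import zify ring lra.

(** Call a vector of ell_2 rapidly decreasing when its coefficients are
    [O(k^-a)] for every [a]. Three facts identify the two modules.

    - The smooth domain [H_infty] consists of the pairs of rapidly decreasing
      vectors ([H_inftyP]): in coordinates the Dirac operator multiplies by the
      index and shifts by one, so its [n]-th power costs [n] orders of decay and
      maps rapidly decreasing pairs to rapidly decreasing pairs.
    - Every element of the algebra maps rapidly decreasing vectors to rapidly
      decreasing vectors ([algA_smooth]). The property, asked of an operator and
      of its adjoint, passes through the star-algebra operations, and it holds
      for the generators: matrices of rapid decay, and Toeplitz operators with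
      smooth symbol, whose entries at [(k, n)] are the Fourier coefficients of
      the symbol at frequency [k - n].
    - [1 - S S^*] is [|e_0><e_0|], so the module it generates is the set of the
      [|v><e_0|] with [v] rapidly decreasing ([cyclic_moduleP]): [a e_0] is such
      a [v] for [a] in the algebra, and [|v><e_0|] has a matrix of rapid decay.

    The isomorphism is then [v |-> |v><e_0|] in each component. It is linear over
    the algebra because [a |v><e_0| = |a v><e_0|], and it preserves the forms
    because [<|v><e_0| e_0, |w><e_0| e_0> = <v, w>].

    All of this presupposes that the adjoint of a bounded operator and the
    orthogonal projection onto ell_2 exist. Both are found by prescribing
    coefficients, so they reduce to the surjectivity of the coefficient map onto
    square-summable sequences ([coef_surj]), which rests on the completeness of
    L_2 of the circle ([riesz_fischer]); uniqueness reduces to the density of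
    finite combinations of basis vectors ([psum_cvg], [functional_eq0]). The
    Fourier analysis, orthonormality of the basis included, comes from a single
    integration by parts around the circle ([fcos_by_parts], [fsin_by_parts]). *)

Set Implicit Arguments.
Unset Strict Implicit.
Unset Printing Implicit Defensive.

Import Order.TTheory GRing.Theory Num.Theory.
Import numFieldNormedType.Exports.

Local Open Scope classical_set_scope.
Local Open Scope ring_scope.
Local Open Scope complex_scope.
(* In [ring_scope] this notation would denote the conjugation of closed numeric
   fields; the inner product is defined with [conjc]. *)
Local Notation "x ^*" := (conjc x) : ring_scope.

(** * The real-valued complex modulus *)

Section Modulus.
Context {R : realType}.
Local Notation C := R[i].

Definition cabs (z : C) : R := Num.sqrt (normsq z).

Lemma normrE (z : C) : `|z| = (cabs z)%:C.
Proof. by rewrite normc_def. Qed.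

Lemma cabs_ge0 (z : C) : 0 <= cabs z.
Proof. exact: sqrtr_ge0. Qed.

Lemma normsq_ge0 (z : C) : 0 <= normsq z.
Proof. by rewrite addr_ge0 // sqr_ge0. Qed.

Lemma sqr_cabs (z : C) : cabs z ^+ 2 = normsq z.
Proof. by rewrite sqr_sqrtr // normsq_ge0. Qed.

Lemma cabsD (x y : C) : cabs (x + y) <= cabs x + cabs y.
Proof. by rewrite -lecR rmorphD /= -!normrE ler_normD. Qed.

Lemma cabsM (x y : C) : cabs (x * y) = cabs x * cabs y.
Proof. by apply: complexI; rewrite rmorphM /= -!normrE normrM. Qed.

Lemma cabsN (x : C) : cabs (- x) = cabs x.
Proof. by apply: complexI; rewrite -!normrE normrN. Qed.

Lemma cabs0 : cabs (0 : C) = 0.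
Proof. by apply: complexI; rewrite -!normrE normr0. Qed.

Lemma cabsJ (x : C) : cabs x^* = cabs x.
Proof. by apply: complexI; rewrite -!normrE normcJ. Qed.

Lemma cabs_real (r : R) : cabs r%:C = `|r|.
Proof. by rewrite /cabs /normsq /= expr0n addr0 sqrtr_sqr. Qed.

Lemma cabs_eq0 (x : C) : cabs x = 0 -> x = 0.
Proof. by move=> x0; apply/eqP; rewrite -normr_eq0 normrE x0. Qed.

Lemma cabs_sum (I : Type) (r : seq I) (F : I -> C) :
  cabs (\sum_(i <- r) F i) <= \sum_(i <- r) cabs (F i).
Proof.
elim/big_ind2: _ => [|x a y b xa yb|//]; first by rewrite cabs0.
exact: le_trans (cabsD _ _) (lerD xa yb).
Qed.

Lemma normsqM (x y : C) : normsq (x * y) = normsq x * normsq y.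
Proof. by rewrite -!sqr_cabs cabsM exprMn. Qed.

Lemma normsqE (x : C) : x^* * x = (normsq x)%:C.
Proof. by rewrite mulrC -sqr_normc normrE -sqr_cabs rmorphXn. Qed.

Lemma conjcD (x y : C) : (x + y)^* = x^* + y^*.
Proof. exact: rmorphD. Qed.

Lemma conjcN (x : C) : (- x)^* = - x^*.
Proof. exact: rmorphN. Qed.

Lemma conjc_sum (I : Type) (r : seq I) (F : I -> C) :
  (\sum_(i <- r) F i)^* = \sum_(i <- r) (F i)^*.
Proof. exact: rmorph_sum. Qed.

Lemma conjc_inv (x : C) : x^*^* = x.
Proof. exact: conjcK. Qed.

Lemma conjcM (x y : C) : (x * y)^* = x^* * y^*.
Proof. exact: rmorphM. Qed.

Lemma cabs_le_ReIm (z : C) : cabs z <= `|complex.Re z| + `|complex.Im z|.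
Proof.
rewrite [z in cabs z]complexE (le_trans (cabsD _ _)) // cabsM !cabs_real.
by rewrite /cabs /normsq /= expr0n add0r expr1n sqrtr1 mul1r.
Qed.

Lemma Re_le_cabs (z : C) : `|complex.Re z| <= cabs z.
Proof. by rewrite -lecR -normrE normc_ge_Re. Qed.

Lemma Im_le_cabs (z : C) : `|complex.Im z| <= cabs z.
Proof. by rewrite -lecR -normrE normc_ge_Im. Qed.

Lemma cisD (s t : R) : cis (s + t) = cis s * cis t.
Proof.
rewrite /cis cosD sinD; apply/eqP; rewrite eq_complex /=.
by apply/andP; split; apply/eqP; ring.
Qed.

Lemma cisX (t : R) n : cis t ^+ n = cis (n%:R * t).
Proof.
elim: n => [|n IH]; first by rewrite mul0r /cis cos0 sin0.
by rewrite exprS IH -cisD -natr1 mulrDl mul1r addrC.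
Qed.

Lemma cisJ (t : R) : (cis t)^* = cis (- t).
Proof. by rewrite /cis /= cosN sinN. Qed.

End Modulus.

(** * The inner product of L_2 of the circle *)

Section InnerProduct.
Context {R : realType}.
Local Notation C := R[i].
Local Notation Re := (@complex.Re R).
Local Notation Im := (@complex.Im R).
Local Notation mu := (mu_circle R).
Local Notation L2 := (L2 R).
Local Notation sqfun := (sqfun R).
Local Open Scope quotient_scope.

Definition cintegrable (f : R -> C) :=
  mu.-integrable setT (EFin \o (Re \o f)) /\
  mu.-integrable setT (EFin \o (Im \o f)).

Lemma integrableDR (f h : R -> R) :
  mu.-integrable setT (EFin \o f) -> mu.-integrable setT (EFin \o h) ->
  mu.-integrable setT (EFin \o (fun t => f t + h t)).
Proof. by move=> fi hi; apply: eq_integrable (integrableD measurableT fi hi). Qed.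

Lemma integrableZR (a : R) (f : R -> R) :
  mu.-integrable setT (EFin \o f) ->
  mu.-integrable setT (EFin \o (fun t => a * f t)).
Proof. by move=> fi; apply: eq_integrable (integrableZl measurableT a fi). Qed.

Lemma integrableBR (f h : R -> R) :
  mu.-integrable setT (EFin \o f) -> mu.-integrable setT (EFin \o h) ->
  mu.-integrable setT (EFin \o (fun t => f t - h t)).
Proof. by move=> fi hi; apply: eq_integrable (integrableB measurableT fi hi). Qed.

Lemma cintegralD (f h : R -> C) : cintegrable f -> cintegrable h ->
  cintegral (fun t => f t + h t) = cintegral f + cintegral h.
Proof.
move=> [fR fI] [hR hI]; rewrite /cintegral; apply/eqP.
rewrite eq_complex /= -!RintegralD //.
by apply/andP; split; apply/eqP; apply: eq_Rintegral => t _;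
   case: (f t) (h t) => ? ? [].
Qed.

Lemma cintegralZ (a : C) (f : R -> C) : cintegrable f ->
  cintegral (fun t => a * f t) = a * cintegral f.
Proof.
case: a => a b [fR fI]; rewrite /cintegral; apply/eqP.
rewrite eq_complex /= -!RintegralZl //.
rewrite -RintegralB //; [|exact: integrableZR..].
rewrite -RintegralD //; [|exact: integrableZR..].
by apply/andP; split; apply/eqP; apply: eq_Rintegral => t _; case: (f t).
Qed.

Lemma cintegralJ (f : R -> C) : cintegrable f ->
  cintegral (fun t => (f t)^*) = (cintegral f)^*.
Proof.
move=> [fR fI]; rewrite /cintegral; apply/eqP.
rewrite eq_complex /= -mulN1r -RintegralZl //.
by apply/andP; split; apply/eqP; apply: eq_Rintegral => t _;
   case: (f t) => ? ? //=; rewrite mulN1r.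
Qed.

Lemma sqfun_mul_integrable (f h : sqfun) :
  cintegrable (fun t => (f t)^* * h t).
Proof.
have /andP[fR fI] := valP f; have /andP[hR hI] := valP h.
have RR := Lfun2_mul_Lfun1 fR hR; have II := Lfun2_mul_Lfun1 fI hI.
have RI := Lfun2_mul_Lfun1 fR hI; have IR := Lfun2_mul_Lfun1 fI hR.
split.
- have := integrableDR ((Lfun1_integrable _ _).1 RR) ((Lfun1_integrable _ _).1 II).
  apply: eq_integrable => // t _ /=.
  by case: (f t) (h t) => ? ? [? ?] /=; rewrite mulNr opprK.
- have := integrableBR ((Lfun1_integrable _ _).1 RI) ((Lfun1_integrable _ _).1 IR).
  apply: eq_integrable => // t _ /=.
  by case: (f t) (h t) => ? ? [? ?] /=; rewrite mulNr.
Qed.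

Lemma cintegral_ae (f h : R -> C) : cintegrable f -> cintegrable h ->
  {ae mu, forall t, f t = h t} -> cintegral f = cintegral h.
Proof.
move=> [fR fI] [hR hI] fh; rewrite /cintegral /Rintegral.
have FF := ae_circle_filter R.
congr (fine _ +i* fine _).
- apply: ae_eq_integral => //; [exact: measurable_int fR|exact: measurable_int hR|].
  by near=> t; move=> _ /=; rewrite (near fh t).
- apply: ae_eq_integral => //; [exact: measurable_int fI|exact: measurable_int hI|].
  by near=> t; move=> _ /=; rewrite (near fh t).
Unshelve. all: by end_near.
Qed.

Lemma repr_ae (f : sqfun) : {ae mu, forall t, repr (\pi_L2 f : L2) t = f t}.
Proof. by apply/L2_eqP; rewrite reprK. Qed.

(** The inner product is defined through chosen representatives; any others give
    the same value. *)
Lemma innerE (f h : sqfun) :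
  innerL2 (\pi_L2 f : L2) (\pi_L2 h) = cintegral (fun t => (f t)^* * h t).
Proof.
have FF := ae_circle_filter R.
apply: cintegral_ae; try exact: sqfun_mul_integrable.
by near=> t; rewrite (near (repr_ae f) t) // (near (repr_ae h) t).
Unshelve. all: by end_near.
Qed.

Lemma innerDr (x y z : L2) : innerL2 x (y + z) = innerL2 x y + innerL2 x z.
Proof.
rewrite -[x]reprK -[y]reprK -[z]reprK piD !innerE.
rewrite -cintegralD; try exact: sqfun_mul_integrable.
by congr cintegral; apply/funext => t; rewrite sqfunDE mulrDr.
Qed.

Lemma innerZr (a : C) (x y : L2) : innerL2 x (a *: y) = a * innerL2 x y.
Proof.
rewrite -[x]reprK -[y]reprK piZ !innerE.
rewrite -cintegralZ; last exact: sqfun_mul_integrable.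
by congr cintegral; apply/funext => t; rewrite sqfunZE mulrCA.
Qed.

Lemma innerJ (x y : L2) : (innerL2 x y)^* = innerL2 y x.
Proof.
rewrite -[x]reprK -[y]reprK !innerE.
rewrite -cintegralJ; last exact: sqfun_mul_integrable.
by congr cintegral; apply/funext => t; rewrite conjcM conjc_inv mulrC.
Qed.

Lemma innerDl (x y z : L2) : innerL2 (x + y) z = innerL2 x z + innerL2 y z.
Proof. by rewrite -[LHS]innerJ innerDr conjcD !innerJ. Qed.

Lemma innerZl (a : C) (x y : L2) : innerL2 (a *: x) y = a^* * innerL2 x y.
Proof. by rewrite -[LHS]innerJ innerZr conjcM innerJ. Qed.

Lemma innerNr (x y : L2) : innerL2 x (- y) = - innerL2 x y.
Proof. by rewrite -scaleN1r innerZr mulN1r. Qed.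

Lemma innerNl (x y : L2) : innerL2 (- x) y = - innerL2 x y.
Proof. by rewrite -[LHS]innerJ innerNr conjcN innerJ. Qed.

Lemma inner0r (x : L2) : innerL2 x 0 = 0.
Proof. by rewrite -(scale0r 0) innerZr mul0r. Qed.

Lemma inner0l (x : L2) : innerL2 0 x = 0.
Proof. by rewrite -[LHS]innerJ inner0r conjc0. Qed.

Lemma innerBr (x y z : L2) : innerL2 x (y - z) = innerL2 x y - innerL2 x z.
Proof. by rewrite innerDr innerNr. Qed.

Definition sqn (x : L2) : R := Re (innerL2 x x).

Lemma innerxx (x : L2) : innerL2 x x = (sqn x)%:C.
Proof.
rewrite [LHS]complexE; suff -> : Im (innerL2 x x) = 0 by rewrite mulr0 addr0.
have := innerJ x x; case: (innerL2 x x) => a b [] /= bE.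
by lra.
Qed.

Lemma sqn_ge0 (x : L2) : 0 <= sqn x.
Proof. exact: sqnorm_ge0. Qed.

Lemma sqr_normL2 (x : L2) : normL2 x ^+ 2 = sqn x.
Proof. by rewrite sqr_sqrtr // sqn_ge0. Qed.

Lemma normL2_ge0 (x : L2) : 0 <= normL2 x.
Proof. exact: sqrtr_ge0. Qed.

(** Definiteness: a vanishing integral of [|f|^2] forces [f = 0] almost
    everywhere, which is equality in the quotient. *)
Lemma sqn_eq0 (x : L2) : sqn x = 0 -> x = 0.
Proof.
have FF := ae_circle_filter R.
rewrite /sqn -[x]reprK sqnormE => x0.
have i0 : (\int[mu]_t `|(normsq (repr x t))%:E| = 0)%E.
  rewrite -(_ : (\int[mu]_t (normsq (repr x t))%:E = 0)%E).
    by apply: eq_integral => t _; rewrite gee0_abs // lee_fin normsq_ge0.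
  have xi := integrable_fin_num measurableT (normsq_integrable (repr x)).
  by move: x0; rewrite /Rintegral -[X in _ -> X = _]fineK // => ->.
have := (ae_eq_integral_abs mu measurableT _).1 i0; move/(_ _) => ae0.
have -> : (0 : L2) = \pi_L2 (0 : sqfun) by rewrite (raddf0 \pi_L2).
apply/L2_eqP.
have {}ae0 := ae0 (measurable_int _ (normsq_integrable (repr x))).
near=> t; apply: cabs_eq0.
have : (normsq (repr x t))%:E = 0%E by apply: (near ae0 t).
by move=> [] n0; rewrite /cabs n0 sqrtr0.
Unshelve. all: by end_near.
Qed.

Lemma sqnZ (a : C) (x : L2) : sqn (a *: x) = normsq a * sqn x.
Proof. exact: sqnormZ. Qed.

Lemma normL2Z (a : C) (x : L2) : normL2 (a *: x) = cabs a * normL2 x.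
Proof. by rewrite /normL2 -/(sqn _) sqnZ sqrtrM // normsq_ge0. Qed.

Lemma sqnD (x y : L2) : sqn (x + y) = sqn x + sqn y + 2 * Re (innerL2 x y).
Proof.
rewrite /sqn innerDl !innerDr -(innerJ x y).
by case: (innerL2 x x) (innerL2 y y) (innerL2 x y) => ? ? [? ?] [? ?] /=; ring.
Qed.

(** Cauchy-Schwarz: expand the square norm of [x] minus its projection onto
    the line spanned by [y]. *)
Lemma cauchy_schwarz_sqr (x y : L2) :
  normsq (innerL2 x y) <= sqn x * sqn y.
Proof.
have [y0|y0] := eqVneq (sqn y) 0.
  by rewrite y0 (sqn_eq0 y0) inner0r /normsq /= expr0n addr0 mulr0.
have y_gt0 : 0 < sqn y by rewrite lt_def y0 sqn_ge0.
set a := innerL2 x y.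
(* [a^* / |y|^2] is the coefficient of the projection of [x] onto [y]. *)
have := sqn_ge0 (x + (- a^* / (sqn y)%:C) *: y).
rewrite sqnD sqnZ innerZr -/a normsqM.
have -> : normsq (- a^*) = normsq a.
  by rewrite -!sqr_cabs cabsN cabsJ.
have -> : normsq ((sqn y)%:C)^-1 = (sqn y ^+ 2)^-1.
  by rewrite -fmorphV /= /normsq /= expr0n addr0 exprVn.
have -> : Re (- a^* / (sqn y)%:C * a) = - normsq a / sqn y.
  by rewrite mulrAC mulNr normsqE -rmorphN -fmorphV -rmorphM.
rewrite -ler_pdivrMr // => H.
suff E : normsq a / sqn y ^+ 2 * sqn y = normsq a / sqn y.
  by move: H; rewrite E; lra.
by field.
Qed.

Lemma cauchy_schwarz (x y : L2) :
  cabs (innerL2 x y) <= normL2 x * normL2 y.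
Proof.
rewrite /cabs /normL2 -sqrtrM ?sqn_ge0 // ler_wsqrtr //.
exact: cauchy_schwarz_sqr.
Qed.

Lemma normL2D (x y : L2) : normL2 (x + y) <= normL2 x + normL2 y.
Proof.
rewrite -(@ler_pXn2r _ 2) ?nnegrE ?addr_ge0 ?normL2_ge0 //.
rewrite sqrrD !sqr_normL2 sqnD.
have := le_trans (ler_norm _) (le_trans (Re_le_cabs _) (cauchy_schwarz x y)).
by lra.
Qed.

End InnerProduct.

(** * Completeness *)

Section Completeness.
Context {R : realType}.
Local Notation C := R[i].
Local Notation Re := (@complex.Re R).
Local Notation Im := (@complex.Im R).
Local Notation mu := (mu_circle R).
Local Notation L2 := (L2 R).
Local Notation sqfun := (sqfun R).
Local Open Scope quotient_scope.

(** Subtracting [2 c 2^-k] makes the sequence nondecreasing, so it converges; the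
    telescoped increments beyond [k] add up to at most [2 c 2^-k]. *)
Lemma cvg_geometric_step (a : R^nat) (c : R) : 0 <= c ->
  (forall k, `|a k.+1 - a k| <= c * 2^-1 ^+ k) ->
  exists2 l, a @ \oo --> l & forall k, `|l - a k| <= 2 * c * 2^-1 ^+ k.
Proof.
move=> c0 ha.
have cX k : 0 <= c * 2^-1 ^+ k by rewrite mulr_ge0 // exprn_ge0 // invr_ge0.
have tail k m : `|a (k + m)%N - a k| <= 2 * c * 2^-1 ^+ k - 2 * c * 2^-1 ^+ (k + m).
  elim: m => [|m IH]; first by rewrite addn0 !subrr normr0.
  have := ha (k + m)%N; rewrite addnS exprS; move: IH.
  rewrite !ler_norml => /andP[? ?] /andP[? ?].
  by apply/andP; split; lra.
have ca : cvgn a.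
  pose b k := a k - 2 * c * 2^-1 ^+ k.
  have cb : cvgn b.
    apply: nondecreasing_is_cvgn.
      apply/nondecreasing_seqP => k; rewrite /b exprS.
      by have := ha k; rewrite ler_norml => /andP[? ?]; lra.
    exists (a 0%N + 2 * c) => _ [k _ <-]; rewrite /b.
    have := tail 0%N k; rewrite add0n expr0 ler_norml => /andP[_ ?].
    by have := cX k; lra.
  have cz : (fun k => 2 * c * 2^-1 ^+ k) @ \oo --> (2 * c * 0 : R).
    apply: cvgM; first exact: cvg_cst.
    by apply: cvg_expr; rewrite ger0_norm ?invr_ge0 // invf_lt1 // ltr1n.
  have -> : a = b \+ (fun k => 2 * c * 2^-1 ^+ k).
    by apply/funext => k; rewrite /b /= subrK.
  by apply: is_cvgD => //; apply/cvg_ex; eexists; exact: cz.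
exists (limn a) => // k.
rewrite ler_norml lerBrDr lerBlDr; apply/andP; split.
  apply: limr_ge => //; near=> m.
  have km : (k <= m)%N by near: m; exists k.
  have := tail k (m - k)%N; rewrite subnKC // ler_norml => /andP[? ?].
  by have := cX m; lra.
apply: limr_le => //; near=> m.
have km : (k <= m)%N by near: m; exists k.
have := tail k (m - k)%N; rewrite subnKC // ler_norml => /andP[? ?].
by have := cX m; lra.
Unshelve. all: by end_near.
Qed.

Lemma Lfun2_sqr_integrable (f : R -> R) : measurable_fun setT f ->
  mu.-integrable setT (EFin \o (fun t => f t ^+ 2)) -> f \in Lfun mu 2%:E.
Proof.
move=> mf fi; apply/andP; split; rewrite inE //= /finite_norm unlock /=.
apply: poweR_lty; have /integrableP[_] := fi; apply: le_lt_trans.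
rewrite le_eqVlt; apply/orP; left; apply/eqP; apply: eq_integral => t _.
rewrite /comp gee0_abs ?lee_fin ?sqr_ge0 //; congr EFin.
by rewrite powR_mulrn // -normrX ger0_norm // sqr_ge0.
Qed.

Lemma sqint_measurable (f : sqfun) :
  measurable_fun setT (Re \o f) /\ measurable_fun setT (Im \o f).
Proof.
have /andP[/andP[fR _] /andP[fI _]] := valP f.
by split; move: fR fI; rewrite !inE.
Qed.

Lemma measurable_normsq (f : R -> C) :
  measurable_fun setT (Re \o f) -> measurable_fun setT (Im \o f) ->
  measurable_fun setT (fun t => normsq (f t)).
Proof.
move=> mR mI; apply: measurable_funD.
  exact: (measurable_funX 2 mR).
exact: (measurable_funX 2 mI).
Qed.

(** The form of square integrability that a monotone bound on the square modulus
    delivers. *)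
Lemma sqintP (f : R -> C) :
  measurable_fun setT (Re \o f) -> measurable_fun setT (Im \o f) ->
  mu.-integrable setT (EFin \o (fun t => normsq (f t))) -> f \in @sqint R.
Proof.
move=> mR mI fi.
have dom (h : R -> R) : measurable_fun setT h ->
    (forall t, h t ^+ 2 <= normsq (f t)) -> h \in Lfun mu 2%:E.
  move=> mh hf; apply: Lfun2_sqr_integrable => //.
  apply: le_integrable fi => //.
    by apply/measurable_EFinP; exact: measurable_funX.
  move=> t _ /=; rewrite lee_fin !ger0_norm ?sqr_ge0 ?normsq_ge0 //.
rewrite inE; apply/andP; split; apply: dom => // t.
  by rewrite lerDl sqr_ge0.
by rewrite lerDr sqr_ge0.
Qed.

Lemma sqnE (f : sqfun) : (sqn (\pi_L2 f))%:E = (\int[mu]_t (normsq (f t))%:E)%E.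
Proof.
rewrite /sqn sqnormE /Rintegral fineK //.
exact: (integrable_fin_num measurableT (normsq_integrable f)).
Qed.

(** Riesz-Fischer. The weighted sum [H] of the squared increments, with weights
    [4^k], has integral at most [2], so it is finite almost everywhere. Where it
    is finite, the [k]-th increment is at most [2^-k] times the square root of
    [H]: the representatives converge pointwise, and the squared distance of the
    [k]-th one to the limit is at most [8 * 4^-k * H], whose integral is at most
    [16 * 4^-k]. *)
Lemma riesz_fischer (u : nat -> L2) :
  (forall k, sqn (u k.+1 - u k) <= 8^-1 ^+ k) ->
  exists y : L2, forall k, sqn (y - u k) <= 16 * 4^-1 ^+ k.
Proof.
move=> hu; pose v k : sqfun := repr (u k).
have uE k : u k = \pi_L2 (v k) by rewrite reprK.
pose g k t : R := normsq ((v k.+1 - v k) t).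
have g0 k t : 0 <= g k t by exact: normsq_ge0.
have gi k : mu.-integrable setT (EFin \o g k) by exact: normsq_integrable.
pose h k t : \bar R := (4 ^+ k * g k t)%:E.
have hi k : mu.-integrable setT (h k) by exact: integrableZR.
have h0 k t : (0 <= h k t)%E by rewrite lee_fin mulr_ge0 // exprn_ge0.
have mh k : measurable_fun setT (h k) by exact: measurable_int (hi k).
pose H t := (\sum_(k <oo) h k t)%E.
have mH : measurable_fun setT H by apply: ge0_emeasurable_sum.
have H0 t : (0 <= H t)%E by apply: nneseries_ge0.
have intH : (\int[mu]_t H t <= 2%:E)%E.
  rewrite integral_nneseries //.
  apply: lime_le; first by apply: is_cvg_nneseries => k _ _; exact: integral_ge0.
  apply: nearW => n; apply: (@le_trans _ _ (2 - 2 * 2^-1 ^+ n)%:E); last first.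
    by rewrite lee_fin lerBlDr lerDl mulr_ge0 // exprn_ge0 // invr_ge0.
  elim: n => [|n IH]; first by rewrite big_nil lee_fin expr0; lra.
  rewrite big_nat_recr //= exprS.
  have -> : 2 - 2 * (2^-1 * 2^-1 ^+ n) = 2 - 2 * 2^-1 ^+ n + 2^-1 ^+ n :> R by lra.
  rewrite EFinD; apply: leeD => // {IH}; move: n => k.
  rewrite /h; under eq_integral do rewrite EFinM.
  rewrite ge0_integralZl_EFin ?exprn_ge0 //; last 2 first.
  - by move=> t _; rewrite lee_fin.
  - exact: measurable_int (gi k).
  have -> : (\int[mu]_t (g k t)%:E = (sqn (u k.+1 - u k))%:E)%E.
    by rewrite !uE -(raddfB \pi_L2) /= sqnE.
  rewrite -EFinM lee_fin.
  have -> : 2^-1 ^+ k = 4 ^+ k * 8^-1 ^+ k :> R.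
    by rewrite -exprMn; congr (_ ^+ k); lra.
  by rewrite ler_wpM2l // exprn_ge0.
have Hi : mu.-integrable setT H.
  apply/integrableP; split => //.
  under eq_integral do rewrite gee0_abs //.
  exact: le_lt_trans intH (ltry _).
have Hfin : {ae mu, forall t, H t \is a fin_num}.
  by apply: filterS (integrable_ae measurableT Hi) => t; exact.
have step t k : H t \is a fin_num ->
    cabs (v k.+1 t - v k t) <= Num.sqrt (fine (H t)) * 2^-1 ^+ k.
  move=> Ht.
  have hk : 4 ^+ k * g k t <= fine (H t).
    rewrite -lee_fin fineK //.
    apply: le_trans (nneseries_lim_ge k.+1 _); last by move=> *; exact: h0.
    by rewrite big_nat_recr //= leeDr // sume_ge0.
  have -> : 2^-1 ^+ k = Num.sqrt (4^-1 ^+ k) :> R.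
    have -> : 4^-1 = 2^-1 ^+ 2 :> R by lra.
    by rewrite -exprM mulnC exprM sqrtr_sqr ger0_norm // exprn_ge0 // invr_ge0.
  rewrite -sqrtrM ?fine_ge0 // ler_wsqrtr // exprVn ler_pdivlMr ?exprn_gt0 //.
  by rewrite mulrC.
have lims t : H t \is a fin_num -> exists l : C,
    [/\ (fun k => Re (v k t)) @ \oo --> Re l,
        (fun k => Im (v k t)) @ \oo --> Im l &
        forall k, normsq (l - v k t) <= 8 * 4^-1 ^+ k * fine (H t)].
  move=> Ht; pose c := Num.sqrt (fine (H t)).
  have c0 : 0 <= c by exact: sqrtr_ge0.
  have c2 : c ^+ 2 = fine (H t) by rewrite sqr_sqrtr // fine_ge0.
  have [|a av aE] := @cvg_geometric_step (fun k => Re (v k t)) c c0.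
    move=> k; apply: le_trans (step t k Ht).
    by apply: le_trans (Re_le_cabs _); case: (v k.+1 t) (v k t) => ? ? [].
  have [|b bv bE] := @cvg_geometric_step (fun k => Im (v k t)) c c0.
    move=> k; apply: le_trans (step t k Ht).
    by apply: le_trans (Im_le_cabs _); case: (v k.+1 t) (v k t) => ? ? [].
  exists (a +i* b); split => // k.
  have -> : 8 * 4^-1 ^+ k * fine (H t) =
      (2 * c * 2^-1 ^+ k) ^+ 2 + (2 * c * 2^-1 ^+ k) ^+ 2.
    have -> : 4^-1 ^+ k = (2^-1 ^+ k) ^+ 2 :> R.
      by rewrite -exprM mulnC exprM; congr (_ ^+ k); lra.
    by rewrite -c2; ring.
  have sqrle (x z : R) : `|x| <= z -> x ^+ 2 <= z ^+ 2.
    by move=> xz; rewrite -(real_normK (num_real x)) ler_sqr ?nnegrE //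
      (le_trans _ xz).
  move: (aE k) (bE k) => /sqrle aE' /sqrle bE'.
  by apply: le_trans (lerD aE' bE'); rewrite /normsq; case: (v k t).
pose N := [set t | H t \is a fin_num].
have mN : measurable N.
  have -> : N = H @^-1` (~` [set +oo%E]).
    apply/seteqP; split => t /=; rewrite /N /= ge0_fin_numE //.
      by move=> /lt_eqF/eqP.
    by move=> /eqP; rewrite ltey.
  rewrite -[X in measurable X]setTI; apply: mH => //.
  exact: measurableC.
(* Off the measurable set [N] of convergence the limit is replaced by 0, so that
   it is an everywhere pointwise limit of the measurable [v k * \1_N]. *)
pose y t : C := if pselect (N t) is left Ht then projT1 (cid (lims t Ht)) else 0.
have mask (p : C -> R) : p 0 = 0 ->
    (forall k, measurable_fun setT (p \o v k)) ->
    (forall t, N t -> (fun k => p (v k t)) @ \oo --> p (y t)) ->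
    measurable_fun setT (p \o y).
  move=> p0 mp cp.
  apply: (@measurable_fun_cvg _ _ R setT
     (fun k t => p (v k t) * \1_N t)) => [k|t _].
    by apply: measurable_funM => //; exact: mp.
  have [Nt|Nt] := pselect (N t).
    rewrite indicE mem_set //=.
    under eq_cvg do rewrite mulr1.
    exact: cp.
  rewrite indicE memNset //=; under eq_cvg do rewrite mulr0.
  have -> : y t = 0 by rewrite /y; case: pselect.
  by rewrite p0; exact: cvg_cst.
have yP t : N t -> [/\ (fun k => Re (v k t)) @ \oo --> Re (y t),
    (fun k => Im (v k t)) @ \oo --> Im (y t) &
     forall k, normsq (y t - v k t) <= 8 * 4^-1 ^+ k * fine (H t)].
  by move=> Nt; rewrite /y; case: pselect => // Ht; case: cid.
have myR : measurable_fun setT (Re \o y).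
  apply: mask => // [k|t Nt]; first by case: (sqint_measurable (v k)).
  by case: (yP t Nt).
have myI : measurable_fun setT (Im \o y).
  apply: mask => // [k|t Nt]; first by case: (sqint_measurable (v k)).
  by case: (yP t Nt).
have mB k : measurable_fun setT (fun t => normsq (y t - v k t)).
  have [mR mI] := sqint_measurable (v k).
  apply: measurable_normsq.
    have := measurable_funB myR mR; apply: eq_measurable_fun => t _ /=.
    by case: (y t) (v k t) => ? ? [].
  have := measurable_funB myI mI; apply: eq_measurable_fun => t _ /=.
  by case: (y t) (v k t) => ? ? [].
have FF := ae_circle_filter R.
have bnd k : (\int[mu]_t (normsq (y t - v k t))%:E <= (16 * 4^-1 ^+ k)%:E)%E.
  apply: (@le_trans _ _ (\int[mu]_t ((8 * 4^-1 ^+ k)%:E * H t))%E).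
    apply: ae_ge0_le_integral => //.
    - by move=> t _; rewrite lee_fin normsq_ge0.
    - by apply/measurable_EFinP; exact: mB.
    - by move=> t _; rewrite mule_ge0 // lee_fin mulr_ge0 // exprn_ge0 // invr_ge0.
    - exact: measurable_funeM.
    near=> t; move=> _; have Ht : N t by apply: (near Hfin t).
    rewrite -(fineK Ht) -EFinM lee_fin.
    by have [_ _] := yP t Ht; exact.
  have k0 : 0 <= 8 * 4^-1 ^+ k :> R by rewrite mulr_ge0 // exprn_ge0 // invr_ge0.
  rewrite ge0_integralZl_EFin //.
  have -> : 16 * 4^-1 ^+ k = 8 * 4^-1 ^+ k * 2 :> R by ring.
  by rewrite [leRHS]EFinM; apply: lee_wpmul2l => //; rewrite lee_fin.
have Bsq k : (fun t => y t - v k t) \in @sqint R.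
  have [mR mI] := sqint_measurable (v k).
  apply: sqintP.
  - have := measurable_funB myR mR; apply: eq_measurable_fun => t _ /=.
    by case: (y t) (v k t) => ? ? [].
  - have := measurable_funB myI mI; apply: eq_measurable_fun => t _ /=.
    by case: (y t) (v k t) => ? ? [].
  apply/integrableP; split; first by apply/measurable_EFinP; exact: mB.
  under eq_integral do rewrite /= ger0_norm ?normsq_ge0 //.
  exact: le_lt_trans (bnd k) (ltry _).
pose d k : sqfun := Sqfun (Bsq k).
exists (\pi_L2 (d 0%N + v 0%N)) => k.
have -> : \pi_L2 (d 0%N + v 0%N) - u k = \pi_L2 (d k) :> L2.
  rewrite uE -(raddfB \pi_L2) /=; congr (\pi_L2 _).
  apply: val_inj; apply/funext => t.
  by change (y t - v 0%N t + v 0%N t - v k t = y t - v k t); rewrite subrK.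
rewrite -lee_fin sqnE; exact: bnd.
Unshelve. all: by end_near.
Qed.

End Completeness.

(** * Fourier coefficients of smooth functions *)

Section Fourier.
Context {R : realType}.
Local Notation C := R[i].
Local Notation Re := (@complex.Re R).
Local Notation Im := (@complex.Im R).
Local Notation mu := (mu_circle R).
Local Notation L2 := (L2 R).
Local Notation sqfun := (sqfun R).
Local Open Scope quotient_scope.

Lemma circle_continuous_integrable (h : R -> R) : continuous h ->
  mu.-integrable setT (EFin \o h).
Proof.
move=> ch; have [M hM] := bounded_2pi ch.
have h1 : (fun t => h t * cst 1 t) \in Lfun mu 2%:E.
  apply: Lfun2_bounded_mul hM _; first exact: continuous_measurable_fun.
  exact: (Lfun_cst mu).
have fin : mu setT \is a fin_num by exact: fin_num_measure.
have := (Lfun1_integrable _ _).1 (Lfun_subset12 fin h1).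
by apply: eq_integrable => // t _ /=; rewrite mulr1.
Qed.

(** The measure of the circle is Lebesgue measure restricted to [[0, 2 pi]]: the
    complement is null, and inside the two measures agree. *)
Lemma Rintegral_circle (h : R -> R) : continuous h ->
  \int[mu]_t h t = \int[lebesgue_measure]_(t in `[0, 2 * pi]) h t.
Proof.
move=> ch; rewrite /Rintegral; congr fine.
have hi := circle_continuous_integrable ch.
have mI : measurable (`[0, 2 * pi]%classic : set (measurableTypeR R)).
  exact: measurable_itv.
rewrite (negligible_integral (measurableC mI)) //=; last first.
  by rewrite /mfrestr /mrestr setICl measure0.
rewrite setTD setCK; apply: eq_measure_integral => A mA Asub.
by rewrite /= /mfrestr /mrestr setIidl.
Qed.

(** Around the circle the boundary terms of the fundamental theorem of calculus
    cancel. *)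
Lemma Rintegral_circle_derive (G h : R -> R) :
  (forall t, is_derive t (1 : R) G (h t)) -> continuous h -> G (2 * pi) = G 0 ->
  \int[mu]_t h t = 0.
Proof.
move=> dG ch G2pi; rewrite Rintegral_circle //.
have cG : continuous G.
  move=> t; apply: differentiable_continuous; apply/derivable1_diffP.
  by case: (dG t).
rewrite /Rintegral (@continuous_FTC2 _ h G) //.
- by rewrite G2pi subee.
- by rewrite mulr_gt0 // pi_gt0.
- exact: continuous_subspaceT.
- split; first by move=> t _; case: (dG t).
    by apply: cvg_at_right_filter; exact: cG.
  by apply: cvg_at_left_filter; exact: cG.
- by move=> t _; rewrite derive1E; case: (dG t).
Qed.

Definition smooth_periodic (h : R -> R) :=
  (forall n t, derivable (derive1n n h) t 1) /\ (forall t, h (t + 2 * pi) = h t).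

Lemma smooth_is_derive (h : R -> R) : smooth_periodic h ->
  forall t, is_derive t (1 : R) h ((derive1 h) t).
Proof. by move=> [dh _] t; apply: DeriveDef; [exact: (dh 0%N)|rewrite derive1E]. Qed.

Lemma smooth_continuous (h : R -> R) : smooth_periodic h -> continuous h.
Proof.
move=> [dh _] t; apply: differentiable_continuous; apply/derivable1_diffP.
exact: (dh 0%N).
Qed.

(** Differentiating the identity [h (t + 2 pi) = h t] shows that the derivative is
    periodic again, which is what lets integration by parts be iterated. *)
Lemma smooth_derive (h : R -> R) : smooth_periodic h -> smooth_periodic (derive1 h).
Proof.
move=> hs; have [dh ph] := hs; split=> [n t|t].
  by rewrite -derive1Sn; exact: dh.
have d1 := smooth_is_derive hs (t + 2 * pi).
have d2 : is_derive t (1 : R) (shift (2 * pi) : R -> R) (1 : R).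
  exact: is_derive_shift.
have := is_derive1_comp (g := shift (2 * pi)) d1 d2.
have -> : h \o shift (2 * pi) = h by apply/funext => s /=; exact: ph.
by rewrite mulr1 => -[_ <-]; rewrite derive1E.
Qed.

Lemma cis_2pi (m : int) : cis (m%:~R * (2 * pi)) = 1 :> C.
Proof.
have cis1 : cis (2 * pi) = 1 :> C.
  by rewrite mulr_natl /cis cos2pi sin2pi.
have nat k : cis (k%:R * (2 * pi)) = 1 :> C by rewrite -cisX cis1 expr1n.
case: m => k; first exact: nat.
by rewrite NegzE mulrNz mulNr -cisJ nat conjc1.
Qed.

Lemma cis_periodic (t : R) : cis (t + 2 * pi) = cis t :> C.
Proof. by rewrite cisD -(mul1r (2 * pi)) (cis_2pi 1) mulr1. Qed.

Definition fcos (h : R -> R) (m : int) : R := \int[mu]_t (h t * cos (m%:~R * t)).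
Definition fsin (h : R -> R) (m : int) : R := \int[mu]_t (h t * sin (m%:~R * t)).

Lemma is_derive_scale (a t : R) : is_derive t (1 : R) (fun s => a * s) a.
Proof.
have d : is_derive t (1 : R) (a \*: (id : R -> R)) (a *: 1) by apply: is_deriveZ.
by apply: is_derive_eq d _; rewrite /GRing.scale /= mulr1.
Qed.

Lemma is_derive_sinm (a t : R) :
  is_derive t (1 : R) (fun s => sin (a * s)) (cos (a * t) * a).
Proof. exact: (is_derive1_comp (is_derive_sin _) (is_derive_scale a t)). Qed.

Lemma is_derive_cosm (a t : R) :
  is_derive t (1 : R) (fun s => cos (a * s)) (- sin (a * t) * a).
Proof. exact: (is_derive1_comp (is_derive_cos _) (is_derive_scale a t)). Qed.

Lemma continuous_sinm (a : R) : continuous (fun s : R => sin (a * s)).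
Proof.
move=> t; apply: differentiable_continuous; apply/derivable1_diffP.
by case: (is_derive_sinm a t).
Qed.

Lemma continuous_cosm (a : R) : continuous (fun s : R => cos (a * s)).
Proof.
move=> t; apply: differentiable_continuous; apply/derivable1_diffP.
by case: (is_derive_cosm a t).
Qed.

Lemma continuousMR (f h : R -> R) : continuous f -> continuous h ->
  continuous (fun t => f t * h t).
Proof. by move=> cf ch t; apply: cvgM; [exact: cf|exact: ch]. Qed.

(** Integration by parts for [h sin (m t)]: both factors are periodic, so the
    derivative of their product integrates to zero. *)
Lemma fcos_by_parts h m : smooth_periodic h ->
  m%:~R * fcos h m = - fsin (derive1 h) m.
Proof.
move=> hs; have ch := smooth_continuous hs.
have ch' := smooth_continuous (smooth_derive hs).
have i1 := circle_continuous_integrable (continuousMR ch (@continuous_cosm m%:~R)).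
have i2 := circle_continuous_integrable (continuousMR ch' (@continuous_sinm m%:~R)).
apply/eqP; rewrite -addr_eq0 /fcos /fsin -RintegralZl //.
rewrite -RintegralD //; last exact: (integrableZR m%:~R i1).
apply/eqP; apply: (@Rintegral_circle_derive (fun t => h t * sin (m%:~R * t))).
- move=> t.
  have d := is_deriveM (smooth_is_derive hs t) (is_derive_sinm m%:~R t).
  set d' := (X in is_derive _ _ _ X).
  have -> : d' = h t *: (cos (m%:~R * t) * m%:~R) + sin (m%:~R * t) *: (derive1 h t).
    by rewrite /d' /GRing.scale /=; ring.
  exact: d.
- move=> t; apply: cvgD; last by have := continuousMR ch' (@continuous_sinm m%:~R); apply.
  by apply: cvgM; [exact: cvg_cst|exact: (continuousMR ch (@continuous_cosm m%:~R))].
- have [_ ph] := hs.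
  by have := cis_2pi m => -[_ ->]; rewrite !mulr0 sin0 mulr0.
Qed.

Lemma fsin_by_parts h m : smooth_periodic h ->
  m%:~R * fsin h m = fcos (derive1 h) m.
Proof.
move=> hs; have ch := smooth_continuous hs.
have ch' := smooth_continuous (smooth_derive hs).
have i1 := circle_continuous_integrable (continuousMR ch (@continuous_sinm m%:~R)).
have i2 := circle_continuous_integrable (continuousMR ch' (@continuous_cosm m%:~R)).
apply/eqP; rewrite eq_sym -subr_eq0 /fcos /fsin -RintegralZl //.
rewrite -RintegralB //; last exact: (integrableZR m%:~R i1).
apply/eqP; apply: (@Rintegral_circle_derive (fun t => h t * cos (m%:~R * t))).
- move=> t.
  have d := is_deriveM (smooth_is_derive hs t) (is_derive_cosm m%:~R t).
  set d' := (X in is_derive _ _ _ X).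
  have -> : d' = h t *: (- sin (m%:~R * t) * m%:~R) + cos (m%:~R * t) *: (derive1 h t).
    by rewrite /d' /GRing.scale /=; ring.
  exact: d.
- move=> t; apply: cvgB; first by have := continuousMR ch' (@continuous_cosm m%:~R); apply.
  by apply: cvgM; [exact: cvg_cst|exact: (continuousMR ch (@continuous_sinm m%:~R))].
- have [_ ph] := hs.
  by have := cis_2pi m => -[-> _]; rewrite mulr0 cos0 -(ph 0) add0r.
Qed.

Lemma Rintegral_trig_le (h w : R -> R) : continuous h -> continuous w ->
  (forall t, `|w t| <= 1) ->
  `|\int[mu]_t (h t * w t)| <= \int[mu]_t `|h t|.
Proof.
move=> ch cw w1; have i1 := circle_continuous_integrable (continuousMR ch cw).
have i0 := circle_continuous_integrable ch.
apply: le_trans (le_normr_Rintegral measurableT i1) _.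
apply: le_Rintegral => //.
- exact: (integrable_norm i1).
- exact: (integrable_norm i0).
by move=> t _ /=; rewrite normrM ler_piMr.
Qed.

(** Each integration by parts gains one power of [m]; the weight [1 + |m|] makes
    the induction uniform in [m], zero included. *)
Lemma fourier_decay (a : nat) (h : R -> R) : smooth_periodic h ->
  exists B, forall m : int,
    (1 + `|m|%:~R) ^+ a * `|fcos h m| <= B /\
    (1 + `|m|%:~R) ^+ a * `|fsin h m| <= B.
Proof.
elim: a h => [|a IH] h hs.
  have ch := smooth_continuous hs.
  exists (\int[mu]_t `|h t|) => m; rewrite !expr0 !mul1r; split.
    apply: Rintegral_trig_le => //; first exact: continuous_cosm.
    by move=> t; rewrite ler_norml cos_geN1 cos_le1.
  apply: Rintegral_trig_le => //; first exact: continuous_sinm.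
  by move=> t; rewrite ler_norml sin_geN1 sin_le1.
have [B hB] := IH h hs; have [B' hB'] := IH _ (smooth_derive hs).
exists (B + B') => m; have [c1 s1] := hB m; have [c2 s2] := hB' m.
rewrite exprSr -!mulrA !mulrDl !mul1r !mulrDr.
have absM (x : R) : (`|m|%:~R : R) * `|x| = `|m%:~R * x|.
  by rewrite normrM intr_norm.
rewrite !absM fcos_by_parts // fsin_by_parts // normrN.
by split; apply: lerD.
Qed.

Lemma fourier_unit : smooth_periodic (cst 1).
Proof.
split=> // n t; suff -> : derive1n n (cst (1 : R)) = cst (n == 0%N)%:R :> (R -> R).
  exact: derivable_cst.
elim: n => // n IH; rewrite derive1nS IH.
by apply/funext => s; rewrite derive1_cst.
Qed.

Lemma mu_circleT : \int[mu]_t (cst 1 t) = 2 * pi :> R.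
Proof.
have c1 : continuous (cst 1 : R -> R) by move=> t; exact: cvg_cst.
rewrite (Rintegral_circle c1) Rintegral_cst //= ?mul1r.
by rewrite lebesgue_measure_itv /= lte_fin mulr_gt0 ?pi_gt0 //= subr0.
Qed.

Lemma two_pi_gt0 : 0 < 2 * pi :> R.
Proof. by rewrite mulr_gt0 // pi_gt0. Qed.

Lemma conj_cis_pair (k n : nat) (t : R) (z : C) :
  (cis t ^+ k / (Num.sqrt (2 * pi))%:C)^* * (z * (cis t ^+ n / (Num.sqrt (2 * pi))%:C))
  = ((2 * pi)^-1)%:C * (z * cis ((n%:Z - k%:Z)%:~R * t)).
Proof.
have sq : (Num.sqrt (2 * pi) : R) ^+ 2 = 2 * pi.
  by rewrite sqr_sqrtr // ltW // two_pi_gt0.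
have s0 : (Num.sqrt (2 * pi))%:C != 0 :> C.
  by rewrite fmorph_eq0 sqrtr_eq0 -ltNge two_pi_gt0.
have -> : (2 * pi)^-1%:C = (Num.sqrt (2 * pi))%:C^-1 ^+ 2 :> C.
  by rewrite exprVn -rmorphXn /= sq fmorphV.
rewrite conjcM -fmorphV conjc_real fmorphV cisX cisJ cisX.
rewrite rmorphB /= mulrBl cisD; field.
exact: s0.
Qed.

Lemma cintegral_cis (f : R -> C) (m : int) :
  continuous (fun t => Re (f t)) -> continuous (fun t => Im (f t)) ->
  let hR := fun t => Re (f t) in let hI := fun t => Im (f t) in
  cintegrable (fun t => f t * cis (m%:~R * t)) /\
  cintegral (fun t => f t * cis (m%:~R * t)) =
  (fcos hR m - fsin hI m) +i* (fsin hR m + fcos hI m).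
Proof.
move=> cR cI hR hI.
have iRc := circle_continuous_integrable (continuousMR cR (@continuous_cosm m%:~R)).
have iRs := circle_continuous_integrable (continuousMR cR (@continuous_sinm m%:~R)).
have iIc := circle_continuous_integrable (continuousMR cI (@continuous_cosm m%:~R)).
have iIs := circle_continuous_integrable (continuousMR cI (@continuous_sinm m%:~R)).
have ER : (fun t => Re (f t * cis (m%:~R * t))) =
    (fun t => hR t * cos (m%:~R * t) - hI t * sin (m%:~R * t)).
  by apply/funext => t; rewrite /hR /hI; case: (f t).
have EI : (fun t => Im (f t * cis (m%:~R * t))) =
    (fun t => hR t * sin (m%:~R * t) + hI t * cos (m%:~R * t)).
  by apply/funext => t; rewrite /hR /hI; case: (f t).
split; first split.
- by have := integrableBR iRc iIs; rewrite -ER.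
- by have := integrableDR iRs iIc; rewrite -EI.
rewrite /cintegral ER EI RintegralB // RintegralD //.
Qed.

(** Orthonormality: for [m <> 0], integrating by parts against the constant [1]
    gives [m] times the integral of [cos (m t)] or [sin (m t)] as the integral of
    zero. *)
Lemma fourier_inner (k n : nat) :
  innerL2 (fourier R k) (fourier R n) = (k == n)%:R.
Proof.
rewrite /fourier innerE /=.
under eq_fun => t do rewrite -[X in _ * X]mul1r conj_cis_pair.
have c1 : continuous (fun t : R => Re (1 : C)) by move=> t; exact: cvg_cst.
have c0 : continuous (fun t : R => Im (1 : C)) by move=> t; exact: cvg_cst.
have [i1 E] := cintegral_cis (f := fun=> 1) (n%:Z - k%:Z) c1 c0.
rewrite cintegralZ // E.
have f0 m : fcos (fun=> 0) m = 0 /\ fsin (fun=> 0) m = 0 :> R.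
  by split; rewrite /fcos /fsin /Rintegral; under eq_integral do rewrite mul0r;
     rewrite integral0.
have [-> ->] := f0 (n%:Z - k%:Z); rewrite subr0 addr0 /=.
have [->|kn] := eqVneq k n.
  rewrite subrr.
  have -> : fcos (fun=> 1) 0 = 2 * pi :> R.
    rewrite -mu_circleT; apply: eq_Rintegral => t _.
    by rewrite mul0r cos0 mulr1.
  have -> : fsin (fun=> 1) 0 = 0 :> R.
    by rewrite -[RHS](f0 0).2; apply: eq_Rintegral => t _; rewrite !mul0r sin0 mulr0.
  rewrite -[_ +i* 0]/((2 * pi)%:C) -rmorphM /= mulVf ?gt_eqF ?two_pi_gt0 //.
have m0 : (n%:Z - k%:Z)%:~R != 0 :> R.
  by rewrite intr_eq0 subr_eq0 eqz_nat eq_sym.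
have d1 : derive1 (cst (1 : R)) = (fun=> 0) by apply/funext => t; rewrite derive1_cst.
have -> : fcos (fun=> 1) (n%:Z - k%:Z) = 0 :> R.
  apply: (mulfI m0); rewrite mulr0 (fcos_by_parts _ fourier_unit) d1.
  by rewrite (f0 _).2 oppr0.
have -> : fsin (fun=> 1) (n%:Z - k%:Z) = 0 :> R.
  apply: (mulfI m0); rewrite mulr0 (fsin_by_parts _ fourier_unit) d1.
  by rewrite (f0 _).1.
by rewrite mulr0.
Qed.

(** Away from representatives: on the class of [h] the multiplication operator is
    the class of the pointwise product. *)
Lemma mulL2_pi (f : C -> C) (fc : continuous_circle f) (h : sqfun) :
  mulL2 f (\pi_L2 h) = \pi_L2 (Sqfun (mul_sqint h fc)).
Proof.
have FF := ae_circle_filter R.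
rewrite /mulL2; apply/L2_eqP; near=> t.
rewrite -/(sqfun_val _) -[sqfun_val (insubd _ _)]/(val (insubd _ _)).
rewrite insubdK; last exact: mul_sqint.
by rewrite (near (repr_ae h) t).
Unshelve. all: by end_near.
Qed.

Lemma mulL2_linear (f : C -> C) (fc : continuous_circle f) (a : C) (x y : L2) :
  mulL2 f (a *: x + y) = a *: mulL2 f x + mulL2 f y.
Proof.
rewrite -[x]reprK -[y]reprK piZ piD !(mulL2_pi fc) piZ piD.
congr (\pi_L2 _); apply: val_inj; apply/funext => t /=.
change (f (cis t) * (a * repr x t + repr y t) =
  a * (f (cis t) * repr x t) + f (cis t) * repr y t).
by rewrite mulrDr mulrCA.
Qed.

Lemma mulL2_bounded (f : C -> C) (fc : continuous_circle f) :
  exists2 M : R, 0 <= M & forall x : L2, normL2 (mulL2 f x) <= M * normL2 x.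
Proof.
have fcis := continuous_symbol fc.
have cR : continuous (fun t => Re (f (cis t))).
  by move=> t; exact: (continuous_comp (fcis t) (@continuous_Re _ _)).
have cI : continuous (fun t => Im (f (cis t))).
  by move=> t; exact: (continuous_comp (fcis t) (@continuous_Im _ _)).
have [MR hR] := bounded_2pi cR; have [MI hI] := bounded_2pi cI.
have M0 : 0 <= MR + MI.
  have t0 : 0 <= (0 : R) <= 2 * pi by rewrite lexx ltW // two_pi_gt0.
  by rewrite addr_ge0 // (le_trans _ (hR 0 t0), le_trans _ (hI 0 t0)).
exists (MR + MI) => // x.
rewrite -(@ler_pXn2r _ 2) ?nnegrE ?mulr_ge0 ?normL2_ge0 // exprMn !sqr_normL2.
rewrite -[x]reprK (mulL2_pi fc) -lee_fin EFinM !sqnE /=.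
have gi := normsq_integrable (repr x).
rewrite -ge0_integralZl_EFin //; last 3 first.
- by move=> t _; rewrite lee_fin normsq_ge0.
- exact: measurable_int gi.
- exact: sqr_ge0.
apply: ae_ge0_le_integral => //.
- by move=> t _; rewrite lee_fin normsq_ge0.
- exact: measurable_int (normsq_integrable (Sqfun (mul_sqint (repr x) fc))).
- by move=> t _; rewrite -EFinM lee_fin mulr_ge0 ?sqr_ge0 ?normsq_ge0.
- exact: measurable_int (integrableZR ((MR + MI) ^+ 2) gi).
exists (~` `[0, 2 * pi]); split.
- exact: measurableC.
- by rewrite /mu_circle /= /mfrestr /mrestr setICl measure0.
apply: subsetC => t /=; rewrite in_itv /= => t2pi _.
rewrite -EFinM lee_fin normsqM ler_wpM2r ?normsq_ge0 //.
rewrite -sqr_cabs ler_sqr ?nnegrE ?cabs_ge0 //.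
exact: le_trans (cabs_le_ReIm _) (lerD (hR t t2pi) (hI t t2pi)).
Qed.

Lemma smooth_circle_periodic (f : C -> C) : smooth_circle f ->
  smooth_periodic (fun t => Re (f (cis t))) /\
  smooth_periodic (fun t => Im (f (cis t))).
Proof.
move=> sf; split; split=> [n t|t]; rewrite ?cis_periodic //.
  by case: (sf n t).
by case: (sf n t).
Qed.

(** The entry at [(k, n)] is a Fourier coefficient of [f] at frequency [k - n], so
    the matrix of multiplication by [f] decays rapidly off the diagonal. *)
Lemma mulL2_fourier_decay (f : C -> C) (a : nat) :
  continuous_circle f -> smooth_circle f ->
  exists B, forall k n : nat,
    (1 + `|n%:Z - k%:Z|%:~R) ^+ a *
      cabs (innerL2 (fourier R k) (mulL2 f (fourier R n))) <= B.
Proof.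
move=> fc sf; have [sR sI] := smooth_circle_periodic sf.
have [B hB] := fourier_decay a sR; have [B' hB'] := fourier_decay a sI.
exists ((2 * pi)^-1 * (B + B' + (B + B'))) => k n.
rewrite /fourier (mulL2_pi fc) innerE /=.
under eq_fun => t do rewrite conj_cis_pair.
have [i1 E] := cintegral_cis (f := fun t => f (cis t)) (n%:Z - k%:Z)
  (smooth_continuous sR) (smooth_continuous sI).
rewrite cintegralZ // E cabsM cabs_real.
have p0 : 0 < (2 * pi : R)^-1 by rewrite invr_gt0 two_pi_gt0.
rewrite (gtr0_norm p0) mulrCA ler_pM2l //.
have [hc hs] := hB (n%:Z - k%:Z); have [hc' hs'] := hB' (n%:Z - k%:Z).
set w := _ ^+ a in hc hs hc' hs' *.
have w0 : 0 <= w by rewrite exprn_ge0 // addr_ge0 // ler0z.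
apply: le_trans (ler_wpM2l w0 (cabs_le_ReIm _)) _ => /=.
rewrite mulrDr lerD //; apply: le_trans (ler_wpM2l w0 (ler_normD _ _)) _.
  by rewrite mulrDr normrN lerD.
by rewrite mulrDr lerD.
Qed.

End Fourier.

(** * The Hilbert space ell_2 and adjoints *)

Section Ell2.
Context {R : realType}.
Local Notation C := R[i].
Local Notation Re := (@complex.Re R).
Local Notation Im := (@complex.Im R).
Local Notation L2 := (L2 R).
Local Notation ell2 := (ell2 R).
Local Notation e := (ebasis R).
Local Open Scope quotient_scope.

Implicit Types (x y z v w : ell2) (c : nat -> C).

Lemma ell2_innerDr x y z : inner_ell2 x (y + z) = inner_ell2 x y + inner_ell2 x z.
Proof. exact: innerDr. Qed.

Lemma ell2_innerDl x y z : inner_ell2 (x + y) z = inner_ell2 x z + inner_ell2 y z.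
Proof. exact: innerDl. Qed.

Lemma ell2_innerZr a x y : inner_ell2 x (a *: y) = a * inner_ell2 x y.
Proof. exact: innerZr. Qed.

Lemma ell2_innerZl a x y : inner_ell2 (a *: x) y = a^* * inner_ell2 x y.
Proof. exact: innerZl. Qed.

Lemma ell2_innerBr x y z : inner_ell2 x (y - z) = inner_ell2 x y - inner_ell2 x z.
Proof. exact: innerBr. Qed.

Lemma ell2_innerJ x y : (inner_ell2 x y)^* = inner_ell2 y x.
Proof. exact: innerJ. Qed.

Lemma ell2_inner0r x : inner_ell2 x 0 = 0.
Proof. exact: inner0r. Qed.

Lemma ell2_cs x y : cabs (inner_ell2 x y) <= norm2 x * norm2 y.
Proof. exact: cauchy_schwarz. Qed.

Lemma norm2_ge0 x : 0 <= norm2 x.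
Proof. exact: normL2_ge0. Qed.

Lemma ell2_innerxx x : inner_ell2 x x = (norm2 x ^+ 2)%:C.
Proof. by rewrite /norm2 sqr_normL2; exact: innerxx. Qed.

Lemma ell2_eq0 x : inner_ell2 x x = 0 -> x = 0.
Proof.
rewrite /inner_ell2 innerxx => /complexI x0.
by apply: val_inj; exact: sqn_eq0.
Qed.

Lemma ell2_inner_inj x y : (forall z, inner_ell2 z x = inner_ell2 z y) -> x = y.
Proof.
move=> xy; apply/eqP; rewrite -subr_eq0; apply/eqP; apply: ell2_eq0.
by rewrite ell2_innerBr xy subrr.
Qed.

Lemma ell2_inner_sumr (I : Type) (r : seq I) x (F : I -> ell2) :
  inner_ell2 x (\sum_(i <- r) F i) = \sum_(i <- r) inner_ell2 x (F i).
Proof.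
by elim/big_rec2: _ => [|i a b _ IH]; rewrite ?ell2_inner0r // ell2_innerDr IH.
Qed.

Lemma basis_inner k n : inner_ell2 (e k) (e n) = (k == n)%:R.
Proof. exact: fourier_inner. Qed.

Lemma normL2_fourier n : normL2 (fourier R n) = 1.
Proof. by rewrite /normL2 fourier_inner eqxx sqrtr1. Qed.

Definition psum c (N : nat) : ell2 := \sum_(n < N) c n *: e n.

Lemma ell2_val_psum c N :
  ell2_val (psum c N) = \sum_(0 <= n < N) c n *: fourier R n.
Proof.
elim: N => [|N IH]; first by rewrite big_nil /psum big_ord0.
by rewrite big_nat_recr //= -IH /psum big_ord_recr.
Qed.

Definition coef v (n : nat) : C := inner_ell2 (e n) v.

Lemma psumS c N : psum c N.+1 = psum c N + c N *: e N.
Proof. by rewrite /psum big_ord_recr. Qed.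

Lemma coef_psum c N k : coef (psum c N) k = if (k < N)%N then c k else 0.
Proof.
rewrite /coef; elim: N => [|N IH]; first by rewrite /psum big_ord0 ell2_inner0r.
rewrite psumS ell2_innerDr ell2_innerZr IH basis_inner [(k < N.+1)%N]ltnS.
by case: ltngtP => [_|_|->]; rewrite ?mulr0 ?addr0 ?mulr1 ?add0r.
Qed.

Lemma innerL2_psum c N (x : L2) :
  innerL2 (psum c N) x = \sum_(n < N) (c n)^* * innerL2 (fourier R n) x.
Proof.
elim: N => [|N IH]; first by rewrite /psum !big_ord0; exact: inner0l.
rewrite psumS big_ord_recr /= -IH -innerZl -innerDl //.
Qed.

Lemma inner_psum c N x :
  inner_ell2 (psum c N) x = \sum_(n < N) (c n)^* * coef x n.
Proof. exact: innerL2_psum. Qed.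

Lemma sqn_psum c N : norm2 (psum c N) ^+ 2 = \sum_(n < N) normsq (c n).
Proof.
apply: complexI; rewrite -ell2_innerxx inner_psum rmorph_sum /=.
by apply: eq_bigr => n _; rewrite coef_psum ltn_ord normsqE.
Qed.

Lemma psum_shift c N M : psum c (N + M) - psum c N =
  psum (fun n => if (n < N)%N then 0 else c n) (N + M).
Proof.
elim: M => [|M IH].
  rewrite addn0 subrr /psum big1 // => n _.
  by rewrite ltn_ord scale0r.
rewrite addnS !psumS -IH addrAC; congr (_ + _ *: _).
by rewrite ltnNge leq_addr.
Qed.

Lemma sqn_psum_diff c N M : (N <= M)%N ->
  norm2 (psum c M - psum c N) ^+ 2 =
  \sum_(n < M) normsq (c n) - \sum_(n < N) normsq (c n).
Proof.
move=> NM; rewrite -(subnKC NM) psum_shift sqn_psum; move: (M - N)%N => d.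
elim: d => [|d IH].
  rewrite addn0 subrr big1 // => n _.
  by rewrite ltn_ord /normsq /= expr0n addr0.
rewrite addnS !big_ord_recr /= IH addrAC.
by rewrite ltnNge leq_addr.
Qed.

(** Bessel's inequality: [p], the [N]-th Fourier sum of [x], satisfies
    [<p, x> = <p, p>], so expanding [0 <= |x - p|^2] gives it. *)
Lemma bessel (x : L2) N :
  \sum_(n < N) normsq (innerL2 (fourier R n) x) <= sqn x.
Proof.
pose c n := innerL2 (fourier R n) x; pose p : L2 := psum c N.
have px : innerL2 p x = (sqn p)%:C.
  rewrite -innerxx -/(inner_ell2 (psum c N) (psum c N)) ell2_innerxx sqn_psum.
  rewrite /p innerL2_psum rmorph_sum; apply: eq_bigr => n _; exact: normsqE.
have -> : \sum_(n < N) normsq (innerL2 (fourier R n) x) = sqn p.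
  by rewrite -[RHS]sqr_normL2 -/(norm2 _) sqn_psum.
have := sqn_ge0 (x - p); rewrite sqnD -scaleN1r sqnZ innerZr mulN1r.
have -> : normsq (-1 : C) = 1 by rewrite /normsq /= oppr0 expr0n addr0 sqrrN expr1n.
have -> : complex.Re (- innerL2 x p) = - sqn p.
  by rewrite -innerJ px conjc_real.
by lra.
Qed.

(** A vector of the closed span is close to some finite combination [w]; once [N]
    exceeds the indices in [w], the remainder [r] of the [N]-th Fourier sum is
    orthogonal to that sum and to [w], so by Pythagoras it is no longer than
    [v - w]. *)
Lemma psum_cvg v (eps : R) : 0 < eps ->
  exists N0, forall N, (N0 <= N)%N -> norm2 (v - psum (coef v) N) < eps.
Proof.
move=> eps0; have /asboolP/(_ _ eps0)[s hs] := valP v.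
exists (\max_(p <- s) p.2.+1) => N hN.
pose w : ell2 := \sum_(p <- s) p.1 *: e p.2.
have wE : ell2_val w = \sum_(p <- s) p.1 *: fourier R p.2.
  rewrite /w; elim: (s) => [|p s' IH]; first by rewrite !big_nil.
  by rewrite !big_cons -IH.
apply: le_lt_trans hs; rewrite -wE.
set r := v - psum (coef v) N.
have r_e k : (k < N)%N -> coef r k = 0.
  by move=> kN; rewrite /coef ell2_innerBr -/(coef (psum _ _) _) coef_psum kN subrr.
have r_w : inner_ell2 r w = 0.
  rewrite ell2_inner_sumr big_seq big1 // => p ps.
  rewrite ell2_innerZr -ell2_innerJ -/(coef _ _) r_e ?conjc0 ?mulr0 //.
  apply: leq_trans hN; exact: (leq_bigmax_seq (F := fun p : C * nat => p.2.+1)).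
have r_p : inner_ell2 r (psum (coef v) N) = 0.
  rewrite -ell2_innerJ inner_psum big1 ?conjc0 // => n _.
  by rewrite r_e ?mulr0.
have E : sqn (ell2_val v - ell2_val w) = sqn r + sqn (psum (coef v) N - w).
  have -> : ell2_val v - ell2_val w = ell2_val r + ell2_val (psum (coef v) N - w).
    by rewrite -[RHS]/(ell2_val (r + (psum (coef v) N - w))) /r addrA subrK.
  rewrite sqnD -/(inner_ell2 r (psum (coef v) N - w)) ell2_innerBr r_w r_p subr0.
  by rewrite mulr0 addr0.
by rewrite ler_wsqrtr // -/(sqn _) -/(sqn _) E lerDl sqn_ge0.
Qed.

(** Boundedness makes [F] continuous, and it vanishes on the dense set of finite
    Fourier sums. Additivity, with no condition on scalars beyond the basis
    vectors, covers linear and conjugate-linear functionals alike. *)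
Lemma functional_eq0 (F : ell2 -> C) (K : R) :
  (forall x y, F (x + y) = F x + F y) ->
  (forall x, cabs (F x) <= K * norm2 x) ->
  (forall a n, F (a *: e n) = 0) -> forall x, F x = 0.
Proof.
move=> FD FK Fe x.
have F0 : F 0 = 0 by have := Fe 0 0%N; rewrite scale0r.
have Fp c N : F (psum c N) = 0.
  elim: N => [|N IH]; first by rewrite /psum big_ord0.
  by rewrite psumS FD IH Fe addr0.
apply: cabs_eq0; apply/eqP; rewrite eq_le cabs_ge0 andbT.
apply/ler_addgt0Pl => eps eps0; rewrite addr0.
have K1 : 0 < `|K| + 1 by rewrite ltr_wpDl.
have [N /(_ N (leqnn N)) hN] := psum_cvg x (divr_gt0 eps0 K1).
rewrite -[x](subrK (psum (coef x) N)) FD Fp addr0.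
apply: le_trans (FK _) _; rewrite ltr_pdivlMr // mulrC in hN.
apply: le_trans (ltW hN); rewrite ler_wpM2r ?norm2_ge0 //.
by rewrite (le_trans (ler_norm K)) // lerDl.
Qed.

Lemma coef_inj v w : (forall n, coef v n = coef w n) -> v = w.
Proof.
move=> vw; apply: ell2_inner_inj => z; apply/eqP; rewrite -subr_eq0; apply/eqP.
rewrite -ell2_innerBr -ell2_innerJ.
rewrite (@functional_eq0 (inner_ell2 (v - w)) (norm2 (v - w))) ?conjc0 // => [x y|x|a n].
- exact: ell2_innerDr.
- exact: ell2_cs.
- by rewrite ell2_innerZr -ell2_innerJ ell2_innerBr -/(coef v n) vw subrr conjc0 mulr0.
Qed.

Lemma coefD v w n : coef (v + w) n = coef v n + coef w n.
Proof. exact: ell2_innerDr. Qed.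

Lemma coefZ a v n : coef (a *: v) n = a * coef v n.
Proof. exact: ell2_innerZr. Qed.

Lemma coef_le v n : cabs (coef v n) <= norm2 v.
Proof.
by apply: le_trans (ell2_cs _ _) _; rewrite /norm2 normL2_fourier mul1r.
Qed.

Lemma geometric_small (eps : R) : 0 < eps ->
  exists k0, forall k, (k0 <= k)%N -> 16 * 4^-1 ^+ k < eps.
Proof.
move=> eps0.
have cz : (fun k => 16 * 4^-1 ^+ k) @ \oo --> (16 * 0 : R).
  apply: cvgM; first exact: cvg_cst.
  by apply: cvg_expr; rewrite ger0_norm ?invr_ge0 // invf_lt1 // ltr1n.
rewrite mulr0 in cz; have /cvgrPdist_lt/(_ eps eps0)[k0 _ hk] := cz.
exists k0 => k kk; have := hk k kk; rewrite /= sub0r normrN ger0_norm //.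
Qed.

(** Every square-summable sequence is the sequence of coefficients of a vector.
    The partial sums of squares increase to their supremum [L]; cutting the series
    where they come within [8^-k] of [L] gives the increments that Riesz-Fischer
    asks for. *)
Lemma coef_surj c (B : R) : (forall N, \sum_(n < N) normsq (c n) <= B) ->
  exists v, forall n, coef v n = c n.
Proof.
move=> cB; pose b N := \sum_(n < N) normsq (c n).
have b_mono N M : (N <= M)%N -> b N <= b M.
  move=> NM; rewrite -subr_ge0 -sqn_psum_diff //; exact: sqr_ge0.
have bsup : has_sup (range b).
  by split; [exists (b 0%N), 0%N|exists B => _ [N _ <-]; exact: cB].
pose L := sup (range b).
have bL N : b N <= L by apply: ub_le_sup; [case: bsup|exists N].
have sub k : exists N, (k <= N)%N /\ L - 8^-1 ^+ k <= b N.
  have p0 : 0 < 8^-1 ^+ k :> R by rewrite exprn_gt0 // invr_gt0.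
  have [_ [N _ <-] hN] := sup_adherent p0 bsup.
  (* Cutting at index [k] or later makes every coefficient appear eventually. *)
  exists (maxn k N); split; first exact: leq_maxl.
  by rewrite (le_trans (ltW hN)) // b_mono // leq_maxr.
have [m hm] := choice sub.
pose u k : L2 := psum c (m k).
have uB N M : (N <= M)%N -> sqn (ell2_val (psum c M) - ell2_val (psum c N)) = b M - b N.
  move=> NM; rewrite -sqn_psum_diff // -sqr_normL2 //.
have [k|y hy] := @riesz_fischer R u.
  have [_ h1] := hm k; have [_ h2] := hm k.+1.
  have l1 := bL (m k); have l2 := bL (m k.+1).
  have h8 : 8^-1 ^+ k.+1 <= 8^-1 ^+ k :> R.
    by rewrite exprS ler_piMl ?exprn_ge0 ?invr_ge0 // invf_le1 // ler1n.
  have [mm|mm] := leqP (m k) (m k.+1).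
    by rewrite /u uB //; lra.
  rewrite -opprB /sqn innerNl innerNr opprK -/(sqn _) /u uB //; last exact: ltnW.
  by lra.
have small (eps : R) : 0 < eps ->
    exists k0, forall k, (k0 <= k)%N -> normL2 (y - u k) < eps.
  move=> eps0; have [k0 hk] := geometric_small (exprn_gt0 2 eps0).
  exists k0 => k kk; rewrite normL2_lt // -/(sqn _).
  exact: le_lt_trans (hy k) (hk k kk).
have yh : y \in @hardy R.
  apply/asboolP => eps eps0; have [k0 hk] := small _ eps0.
  exists [seq (c n, n) | n <- iota 0 (m k0)].
  have := hk k0 (leqnn _); rewrite /u ell2_val_psum /index_iota subn0.
  by rewrite big_map.
exists (Ell2 yh) => n; apply/eqP; rewrite -subr_eq0; apply/eqP.
apply: cabs_eq0; apply/eqP; rewrite eq_le cabs_ge0 andbT.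
apply/ler_addgt0Pl => eps eps0; rewrite addr0.
have [k0 hk] := small _ eps0; set k := maxn k0 n.+1.
have nk : (n < m k)%N.
  by have [h _] := hm k; apply: leq_trans h; exact: leq_maxr.
have -> : c n = innerL2 (fourier R n) (u k).
  by rewrite -[RHS]/(coef (psum c (m k)) n) coef_psum nk.
rewrite -[coef _ _]/(innerL2 (fourier R n) y) -innerBr.
apply: le_trans (cauchy_schwarz _ _) _; rewrite normL2_fourier mul1r.
by apply: ltW; apply: hk; exact: leq_maxl.
Qed.

(** ** Bounded operators *)

Lemma bounded_opP (A : operator R) : bounded_op A ->
  linear A /\ exists2 M : R, 0 <= M & forall x, norm2 (A x) <= M * norm2 x.
Proof.
move=> [lA [M hM]]; split=> //; exists `|M| => // x.
by apply: le_trans (hM x) _; rewrite ler_wpM2r ?norm2_ge0 // ler_norm.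
Qed.

Lemma linear_opD (A : operator R) x y : linear A -> A (x + y) = A x + A y.
Proof. by move=> lA; rewrite -[x]scale1r lA !scale1r. Qed.

Lemma linear_op0 (A : operator R) : linear A -> A 0 = 0.
Proof.
move=> lA; have := linear_opD 0 0 lA; rewrite addr0 => /esym/eqP.
by rewrite -subr_eq0 addrK => /eqP.
Qed.

Lemma linear_opZ (A : operator R) a x : linear A -> A (a *: x) = a *: A x.
Proof. by move=> lA; rewrite -[a *: x]addr0 lA linear_op0 // addr0. Qed.

Lemma linear_op_psum (A : operator R) c N : linear A ->
  A (psum c N) = \sum_(n < N) c n *: A (e n).
Proof.
move=> lA; elim: N => [|N IH]; first by rewrite /psum !big_ord0 linear_op0.
by rewrite psumS big_ord_recr /= -IH linear_opD // linear_opZ.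
Qed.

(** The prospective vector [A^* y] has coefficients [c_k = <A e_k, y>]. For the
    truncation [p] of [c], [|p|^2 = <A p, y> <= M |y| |p|], hence [|p| <= M |y|]:
    the coefficients are square summable. *)
Lemma adjoint_vector (A : operator R) y : bounded_op A ->
  exists z, forall x, inner_ell2 (A x) y = inner_ell2 x z.
Proof.
move=> /bounded_opP[lA [M M0 hM]].
pose c k := inner_ell2 (A (e k)) y.
have [N|z hz] := @coef_surj c ((M * norm2 y) ^+ 2).
  set s := \sum_(n < N) _.
  have sE : inner_ell2 (A (psum c N)) y = s%:C.
    rewrite linear_op_psum // -[LHS]ell2_innerJ ell2_inner_sumr conjc_sum.
    rewrite [RHS]rmorph_sum; apply: eq_bigr => n _.
    rewrite ell2_innerZr conjcM ell2_innerJ -/(c n).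
    exact: normsqE.
  have s0 : 0 <= s by apply: sumr_ge0 => n _; exact: normsq_ge0.
  have := ell2_cs (A (psum c N)) y; rewrite sE cabs_real ger0_norm //.
  move=> h; have {h} : s <= M * norm2 y * norm2 (psum c N).
    by apply: le_trans h _; rewrite mulrAC ler_wpM2r ?norm2_ge0.
  have := norm2_ge0 (psum c N); have := mulr_ge0 M0 (norm2_ge0 y).
  have -> : s = norm2 (psum c N) ^+ 2 by rewrite sqn_psum.
  set p := norm2 (psum _ _); set q := M * _ => q0 p0 h.
  rewrite ler_sqr ?nnegrE //; have [->//|p1] := eqVneq p 0.
  by rewrite -(ler_pM2r (_ : 0 < p)) // ?lt_def ?p1 // -expr2.
exists z => x; apply/eqP; rewrite -subr_eq0; apply/eqP.
pose F x := (inner_ell2 (A x) y - inner_ell2 x z)^*.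
suff : F x = 0 by move=> h; rewrite -[LHS]conjc_inv -/(F x) h conjc0.
apply: (@functional_eq0 F (M * norm2 y + norm2 z)) => {x} [x x'|x|a n]; rewrite /F.
- by rewrite linear_opD // !ell2_innerDl -conjcD; congr conjc; ring.
- rewrite cabsJ mulrDl (le_trans (cabsD _ _)) // cabsN lerD //.
    apply: le_trans (ell2_cs _ _) _; rewrite mulrAC ler_wpM2r ?norm2_ge0 //.
  by apply: le_trans (ell2_cs _ _) _; rewrite mulrC.
rewrite linear_opZ // !ell2_innerZl -/(coef z n) hz -/(c n).
by rewrite subrr conjc0.
Qed.

(** The adjoint is selected by its defining identity, so any operator satisfying
    the identity is the adjoint. *)
Lemma adjoint_spec (A B : operator R) :
  (forall x y, inner_ell2 (A x) y = inner_ell2 x (B y)) -> adjoint A = B.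
Proof.
move=> AB; rewrite /adjoint; case: xgetP => [B' _ AB'|/(_ B)]; last by case.
apply/funext => y; apply: ell2_inner_inj => x.
by rewrite -AB -AB'.
Qed.

Lemma adjointP (A : operator R) : bounded_op A ->
  forall x y, inner_ell2 (A x) y = inner_ell2 x (adjoint A y).
Proof.
move=> bA; have [B hB] := choice (fun y => adjoint_vector y bA).
by move=> x y; rewrite (@adjoint_spec A B).
Qed.

Lemma adjoint_bounded (A : operator R) : bounded_op A -> bounded_op (adjoint A).
Proof.
move=> bA; have AP := adjointP bA; have [lA [M M0 hM]] := bounded_opP bA.
split=> [a x y|].
  apply: ell2_inner_inj => z.
  by rewrite -AP !ell2_innerDr !ell2_innerZr !AP.
exists M => y; have := ell2_cs (A (adjoint A y)) y.
rewrite AP ell2_innerxx cabs_real ger0_norm ?sqr_ge0 // => h.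
have {}h : norm2 (adjoint A y) ^+ 2 <= M * norm2 y * norm2 (adjoint A y).
  by apply: le_trans h _; rewrite mulrAC ler_wpM2r ?norm2_ge0.
have := norm2_ge0 (adjoint A y); have := mulr_ge0 M0 (norm2_ge0 y).
move: h; set p := norm2 _; set q := M * _ => h q0 p0.
have [->//|p1] := eqVneq p 0.
by rewrite -(ler_pM2r (_ : 0 < p)) // ?lt_def ?p1 // -expr2.
Qed.

Lemma adjointK (A : operator R) : bounded_op A -> adjoint (adjoint A) = A.
Proof.
move=> bA; apply: adjoint_spec => x y.
by rewrite -[LHS]ell2_innerJ -adjointP // ell2_innerJ.
Qed.

Lemma bounded_opD (A B : operator R) :
  bounded_op A -> bounded_op B -> bounded_op (A + B).
Proof.
move=> [lA [M hM]] [lB [K hK]]; split=> [a x y|].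
  by rewrite !fctE lA lB scalerDr addrACA.
exists (M + K) => x; rewrite mulrDl.
exact: le_trans (normL2D _ _) (lerD (hM x) (hK x)).
Qed.

Lemma bounded_opZ a (A : operator R) : bounded_op A -> bounded_op (a *: A).
Proof.
move=> [lA [M hM]]; split=> [b x y|].
  by rewrite -[RHS]/(b *: (a *: A x) + a *: A y) -[LHS]/(a *: A (b *: x + y)) lA
    scalerDr !scalerA mulrC.
exists (cabs a * M) => x; rewrite -mulrA.
have -> : norm2 ((a *: A) x) = cabs a * norm2 (A x) by exact: normL2Z.
by rewrite ler_wpM2l ?cabs_ge0.
Qed.

Lemma bounded_op_comp (A B : operator R) :
  bounded_op A -> bounded_op B -> bounded_op (A \o B).
Proof.
move=> /bounded_opP[lA [M M0 hM]] [lB [K hK]]; split=> [a x y|].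
  by rewrite /= lB lA.
exists (M * K) => x; rewrite -mulrA.
by apply: le_trans (hM _) _; rewrite ler_wpM2l.
Qed.

(** ** The orthogonal projection and Toeplitz operators *)

(** Bessel makes the coefficients of [x] square summable, so some vector of ell_2
    has the same ones; the difference is orthogonal to the basis, hence to its
    closed span. *)
Lemma projH_ex (x : L2) : exists y : ell2,
  forall z : ell2, innerL2 z (x - ell2_val y) = 0.
Proof.
have [|y hy] := @coef_surj (fun n => innerL2 (fourier R n) x) (sqn x).
  by move=> N; exact: bessel.
exists y => z.
pose F z : C := (innerL2 (ell2_val z) (x - ell2_val y))^*.
suff : F z = 0 by move=> h; rewrite -[LHS]conjc_inv -/(F z) h conjc0.
apply: (@functional_eq0 F (normL2 (x - ell2_val y))) => {z} [z z'|z|a n]; rewrite /F.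
- by rewrite -conjcD -innerDl.
- by rewrite cabsJ mulrC cauchy_schwarz.
rewrite -[ell2_val _]/(a *: fourier R n) innerZl innerBr.
by rewrite -[innerL2 _ (ell2_val y)]/(coef y n) hy subrr mulr0 conjc0.
Qed.

Lemma projHP (x : L2) (z : ell2) : innerL2 z (projH x) = innerL2 z x.
Proof.
have [y hy] := projH_ex x.
rewrite /projH; case: xgetP => [y' _ hy'|/(_ y)]; last by case.
by have := hy' z; rewrite innerBr => /eqP; rewrite subr_eq0 => /eqP ->.
Qed.

Lemma projH_id v : projH (ell2_val v) = v.
Proof. by apply: ell2_inner_inj => z; exact: projHP. Qed.

Lemma projH_linear a (x y : L2) : projH (a *: x + y) = a *: projH x + projH y.
Proof.
apply: ell2_inner_inj => z.
rewrite ell2_innerDr ell2_innerZr /inner_ell2 !projHP.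
by rewrite innerDr innerZr.
Qed.

Lemma projH_le (x : L2) : norm2 (projH x) <= normL2 x.
Proof.
have := cauchy_schwarz (projH x) x.
rewrite -projHP innerxx -sqr_normL2 cabs_real ger0_norm ?sqr_ge0 //.
rewrite -/(norm2 _) expr2.
have [->|p1] := eqVneq (norm2 (projH x)) 0; first by rewrite normL2_ge0.
by rewrite ler_pM2l // lt_def p1 norm2_ge0.
Qed.

Lemma toeplitz_bounded (f : C -> C) : continuous_circle f ->
  bounded_op (toeplitz f).
Proof.
move=> fc; have [M M0 hM] := mulL2_bounded fc; split=> [a x y|].
  by rewrite /toeplitz -projH_linear -(mulL2_linear fc).
exists M => x; exact: le_trans (projH_le _) (hM _).
Qed.

Lemma toeplitz_coef (f : C -> C) k n :
  coef (toeplitz f (e n)) k = innerL2 (fourier R k) (mulL2 f (fourier R n)).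
Proof. exact: (projHP _ (e k)). Qed.

End Ell2.

(** * Rapidly decreasing vectors *)

Section Schwartz.
Context {R : realType}.
Local Notation C := R[i].
Local Notation L2 := (L2 R).
Local Notation ell2 := (ell2 R).
Local Notation e := (ebasis R).
Implicit Types (x y z v w : ell2) (A B : operator R).

Definition schwartz v := forall a : nat, exists K : R, forall k : nat,
  k.+1%:R ^+ a * cabs (coef v k) <= K.

Lemma schwartz0 : schwartz 0.
Proof.
move=> a; exists 0 => k.
by rewrite /coef ell2_inner0r cabs0 mulr0.
Qed.

Lemma schwartzD v w : schwartz v -> schwartz w -> schwartz (v + w).
Proof.
move=> sv sw a; have [K hK] := sv a; have [L hL] := sw a.
exists (K + L) => k; rewrite coefD.
apply: le_trans (lerD (hK k) (hL k)); rewrite -mulrDr ler_wpM2l //.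
exact: cabsD.
Qed.

Lemma schwartzZ c v : schwartz v -> schwartz (c *: v).
Proof.
move=> sv a; have [K hK] := sv a.
by exists (cabs c * K) => k; rewrite coefZ cabsM mulrCA ler_wpM2l // cabs_ge0.
Qed.

Lemma schwartz_ge0 v a : schwartz v ->
  exists2 K : R, 0 <= K & forall k : nat, k.+1%:R ^+ a * cabs (coef v k) <= K.
Proof.
move=> /(_ a)[K hK]; exists K => //; apply: le_trans (hK 0%N).
by rewrite mulr_ge0 // cabs_ge0.
Qed.

Lemma sum_inv_sqr N : \sum_(n < N) (n.+1%:R ^+ 2)^-1 <= 2 :> R.
Proof.
suff h : \sum_(n < N) (n.+1%:R ^+ 2)^-1 <= 2 - 2 / N.+1%:R :> R.
  by apply: le_trans h _; rewrite lerBlDr lerDl divr_ge0.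
elim: N => [|N IH]; first by rewrite big_ord0 divr1 subrr.
rewrite big_ord_recr /=; apply: le_trans (lerD IH (lexx _)) _.
have x1 : 1 <= N.+1%:R :> R by rewrite ler1n.
rewrite -[N.+2%:R]natr1; move: (N.+1%:R) x1 => x x1.
rewrite -subr_ge0.
have -> : 2 - 2 / (x + 1) - (2 - 2 / x + (x ^+ 2)^-1) =
  (x - 1) / (x ^+ 2 * (x + 1)) :> R.
  by field; apply/andP; split; lra.
by rewrite divr_ge0 ?mulr_ge0 ?sqr_ge0; lra.
Qed.

(** Both kinds of generators satisfy this: matrices of rapid decay with [b = 0],
    Toeplitz matrices with [b = a]. *)
Definition tempered A := forall a : nat, exists (K : R) (b : nat), forall k n : nat,
  k.+1%:R ^+ a * cabs (coef (A (e n)) k) <= K * n.+1%:R ^+ b.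

(** The weighted [k]-th coefficient of [A v] is at most the sum over [n] of
    [K (n+1)^b |v_n|], and [|v_n|] is bounded by a multiple of [(n+1)^(-b-2)]. The
    infinite sum is avoided by splitting off the remainder of a Fourier sum of
    [v], on which boundedness of [A] is enough. *)
Lemma tempered_schwartz A v :
  bounded_op A -> tempered A -> schwartz v -> schwartz (A v).
Proof.
move=> bA tA sv a; have [K [b hK]] := tA a.
have [L L0 hL] := schwartz_ge0 b.+2 sv.
have K0 : 0 <= K.
  have := hK 0%N 0%N; rewrite !expr1n mul1r mulr1.
  by apply: le_trans; exact: cabs_ge0.
have [lA [M M0 hM]] := bounded_opP bA.
exists (K * L * 2) => k.
have w0 : 0 < k.+1%:R ^+ a :> R by rewrite exprn_gt0 // ltr0n.
apply/ler_addgt0Pl => eps eps0.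
have d0 : 0 < eps / (k.+1%:R ^+ a * (M + 1)).
  by rewrite divr_gt0 // mulr_gt0 // ltr_wpDl.
have [N /(_ N (leqnn N)) hN] := psum_cvg v d0.
rewrite -[v in A v](subrK (psum (coef v) N)) linear_opD // coefD.
apply: le_trans (ler_wpM2l (ltW w0) (cabsD _ _)) _; rewrite mulrDr lerD //.
  have h : cabs (coef (A (v - psum (coef v) N)) k) <=
      M * (eps / (k.+1%:R ^+ a * (M + 1))).
    apply: le_trans (coef_le _ _) (le_trans (hM _) _).
    by rewrite ler_wpM2l // ltW.
  apply: le_trans (ler_wpM2l (ltW w0) h) _.
  have -> : k.+1%:R ^+ a * (M * (eps / (k.+1%:R ^+ a * (M + 1)))) = eps * (M / (M + 1)).
    by field; rewrite gt_eqF // ?ltr_wpDl // gt_eqF // ltr0n.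
  by rewrite ler_piMr ?(ltW eps0) // ler_pdivrMr ?ltr_wpDl //; lra.
rewrite linear_op_psum // /coef ell2_inner_sumr.
apply: le_trans (ler_wpM2l (ltW w0) (cabs_sum _ _)) _.
rewrite mulr_sumr; apply: le_trans (ler_wpM2l (mulr_ge0 K0 L0) (sum_inv_sqr N)).
rewrite mulr_sumr; apply: ler_sum => n _.
rewrite ell2_innerZr -/(coef (A (e n)) k) -/(coef v n) cabsM mulrCA.
have h1 := hK k n; have h2 := hL n.
have n0 : 0 < n.+1%:R :> R by rewrite ltr0n.
apply: le_trans (ler_wpM2l (cabs_ge0 _) h1) _.
rewrite mulrCA -[K * L * _]mulrA ler_wpM2l // ler_pdivlMr ?exprn_gt0 //.
by move: h2; rewrite -addn2 exprD; congr (_ <= _); ring.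
Qed.

End Schwartz.

(** * The operator algebra preserves rapid decay *)

Section Algebra.
Context {R : realType}.
Local Notation C := R[i].
Local Notation ell2 := (ell2 R).
Local Notation e := (ebasis R).
Implicit Types (x y z v w : ell2) (A B : operator R).

Definition preserves_schwartz A := forall v, schwartz v -> schwartz (A v).

(** The adjoint is included because the algebra is closed under adjoints. *)
Definition smooth_op A :=
  [/\ bounded_op A, preserves_schwartz A & preserves_schwartz (adjoint A)].

Lemma adjoint_coef A k n : bounded_op A ->
  coef (adjoint A (e n)) k = (coef (A (e k)) n)^*.
Proof. by move=> bA; rewrite /coef -adjointP // ell2_innerJ. Qed.

(** The matrix of the adjoint is the conjugate transpose, so growth bounds in both
    directions handle an operator together with its adjoint. *)
Lemma tempered_smooth A : bounded_op A ->
  (forall a, exists (K : R) (b : nat), forall k n : nat,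
     k.+1%:R ^+ a * cabs (coef (A (e n)) k) <= K * n.+1%:R ^+ b /\
     n.+1%:R ^+ a * cabs (coef (A (e n)) k) <= K * k.+1%:R ^+ b) ->
  smooth_op A.
Proof.
move=> bA hA; split=> // v; apply: tempered_schwartz => //.
- by move=> a; have [K [b hK]] := hA a; exists K, b => k n; case: (hK k n).
- exact: adjoint_bounded.
move=> a; have [K [b hK]] := hA a; exists K, b => k n.
by rewrite adjoint_coef // cabsJ; case: (hK n k).
Qed.

Lemma smooth_op_star_algebra (G : set (operator R)) :
  (forall A, G A -> smooth_op A) -> forall A, star_algebra G A -> smooth_op A.
Proof.
move=> GA A; elim=> {A} [A /GA//|A B _ [bA pA qA] _ [bB pB qB]|c A _ [bA pA qA]
  |A B _ [bA pA qA] _ [bB pB qB]|A _ [bA pA qA]].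
- split; first exact: bounded_opD.
    by move=> v sv; apply: schwartzD; [exact: pA|exact: pB].
  rewrite (@adjoint_spec _ _ (adjoint A + adjoint B)) => [v sv|x y].
    by apply: schwartzD; [exact: qA|exact: qB].
  rewrite -[(A + B) x]/(A x + B x) -[(_ + _) y]/(adjoint A y + adjoint B y).
  by rewrite ell2_innerDl ell2_innerDr !adjointP.
- split; first exact: bounded_opZ.
    by move=> v sv; apply: schwartzZ; exact: pA.
  rewrite (@adjoint_spec _ _ (c^* *: adjoint A)) => [v sv|x y].
    by apply: schwartzZ; exact: qA.
  rewrite -[(c *: A) x]/(c *: A x) -[(_ *: adjoint A) y]/(c^* *: adjoint A y).
  by rewrite ell2_innerZl ell2_innerZr adjointP.
- split; first exact: bounded_op_comp.
    by move=> v sv; apply: pA; exact: pB.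
  rewrite (@adjoint_spec _ _ (adjoint B \o adjoint A)) => [v sv|x y].
    by apply: qB; exact: qA.
  by rewrite /= !adjointP.
- by split; [exact: adjoint_bounded|exact: qA|rewrite adjointK].
Qed.

Lemma cabs_natX n a : cabs (n%:R ^+ a : C) = n%:R ^+ a.
Proof. by rewrite -[n%:R](rmorph_nat (real_complex R)) -rmorphXn /= cabs_real ger0_norm. Qed.

(** Away from finitely many indices the weight [k ^ a] is enough; the index
    [k = 0], where that weight may vanish, is covered by the uniform bound. *)
Lemma weight_bound (r : nat -> nat -> R) (M : R) (a : nat) :
  (forall k n, 0 <= r k n <= M) ->
  (exists m : nat, forall k n, (m <= k + n)%N -> k%:R ^+ a * r k n < 1) ->
  exists K, forall k n : nat, k.+1%:R ^+ a * r k n <= K.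
Proof.
move=> rM [m hm].
have M0 : 0 <= M by have /andP[r0 ?] := rM 0%N 0%N; exact: le_trans r0 _.
exists (2 ^+ a * (1 + M) + m.+1%:R ^+ a * M) => k n.
have /andP[r0 r1] := rM k n.
have [kn|kn] := leqP m (k + n).
  apply: (@le_trans _ _ (2 ^+ a * (1 + M))); last first.
    by rewrite lerDl mulr_ge0.
  apply: (@le_trans _ _ (2 ^+ a * ((k%:R ^+ a + 1) * r k n))); last first.
    rewrite ler_wpM2l // mulrDl mul1r lerD //; apply: ltW; exact: hm.
  rewrite mulrA ler_wpM2r //; case: k {kn r0 r1} => [|k].
    have h2 : 1 <= 2 ^+ a :> R by rewrite exprn_ege1 // ler1n.
    have h0 : 0 <= 0%:R ^+ a :> R by exact: exprn_ge0.
    by rewrite expr1n; nra.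
  apply: (@le_trans _ _ (2 ^+ a * k.+1%:R ^+ a)).
    rewrite -exprMn lerXn2r ?nnegrE ?mulr_ge0 // -natrM ler_nat; lia.
  by rewrite ler_wpM2l // lerDl.
apply: (@le_trans _ _ (m.+1%:R ^+ a * M)); last first.
  by rewrite lerDr mulr_ge0 // addr_ge0.
rewrite ler_pM // lerXn2r ?nnegrE // ler_nat; lia.
Qed.

Lemma KS_smooth A : K_S A -> smooth_op A.
Proof.
move=> [bA dA]; have [_ [M M0 hM]] := bounded_opP bA.
have cM k n : 0 <= cabs (coef (A (e n)) k) <= M.
  rewrite cabs_ge0 (le_trans (coef_le _ _)) // (le_trans (hM _)) //.
  by rewrite /norm2 normL2_fourier mulr1.
apply: tempered_smooth => // a.
have dA' alpha beta : exists m : nat, forall k n, (m <= k + n)%N ->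
    k%:R ^+ alpha * cabs (coef (A (e n)) k) * n%:R ^+ beta < 1.
  have [m hm] := dA alpha beta 1 ltr01; exists m => k n kn.
  by have := hm k n kn; rewrite normrE ltcR !cabsM !cabs_natX.
have [K1 h1] : exists K, forall k n : nat,
    k.+1%:R ^+ a * cabs (coef (A (e n)) k) <= K.
  apply: (weight_bound cM); have [m hm] := dA' a 0%N; exists m => k n kn.
  by have := hm k n kn; rewrite expr0 mulr1.
have [K2 h2] : exists K, forall n k : nat,
    n.+1%:R ^+ a * cabs (coef (A (e n)) k) <= K.
  apply: (@weight_bound (fun n k => cabs (coef (A (e n)) k)) M) => //.
  have [m hm] := dA' 0%N a; exists m => n k nk.
  by have := hm k n; rewrite addnC expr0 mul1r mulrC; apply.
exists (`|K1| + `|K2|), 0%N => k n; rewrite !expr0 !mulr1; split.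
  by apply: le_trans (h1 k n) (le_trans (ler_norm _) _); rewrite lerDl.
by apply: le_trans (h2 n k) (le_trans (ler_norm _) _); rewrite lerDr.
Qed.

(** Off-diagonal decay gives [(1 + |n - k|)^a |t_kn| <= K], and
    [k + 1 <= (n + 1) (1 + |n - k|)]; the same with [k] and [n] exchanged. *)
Lemma toeplitz_smooth (f : C -> C) :
  continuous_circle f -> smooth_circle f -> smooth_op (toeplitz f).
Proof.
move=> fc sf; apply: tempered_smooth; first exact: toeplitz_bounded.
move=> a; have [K hK] := mulL2_fourier_decay a fc sf.
exists K, a => k n; rewrite toeplitz_coef.
have h := hK k n; set c := cabs _ in h *.
have c0 : 0 <= c by exact: cabs_ge0.
set d : R := (`|n%:Z - k%:Z|%:~R) in h.
have dE : d = `|n%:R - k%:R| by rewrite /d intr_norm rmorphB.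
have d0 : 0 <= d by rewrite dE.
have shift (i j : nat) : i%:R <= j%:R + d ->
    i.+1%:R ^+ a * c <= K * j.+1%:R ^+ a.
  move=> ij; apply: (@le_trans _ _ ((j.+1%:R * (1 + d)) ^+ a * c)).
    rewrite ler_wpM2r // lerXn2r ?nnegrE ?mulr_ge0 ?addr_ge0 //.
    rewrite -[i.+1%:R]natr1 -[j.+1%:R]natr1.
    have : 0 <= j%:R :> R by [].
    by move: ij; move: (i%:R) (j%:R) => p q; nra.
  by rewrite exprMn -mulrA [leRHS]mulrC ler_wpM2l // exprn_ge0.
by split; apply: shift; move: (ler_norm (n%:R - k%:R : R)) (ler_norm (-(n%:R - k%:R) : R));
  rewrite ?normrN -dE; lra.
Qed.

Lemma algA_smooth g A : algA g A -> smooth_op A.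
Proof.
apply: smooth_op_star_algebra => {}A [/KS_smooth//|[f [sf [fc _]] <-]].
exact: toeplitz_smooth.
Qed.

(** The constant symbol [1] is smooth and compatible with every gluing of arcs, so
    the algebra is unital. *)
Lemma algA_id g : algA g (id : operator R).
Proof.
apply: Star_gen; right.
have c1 : continuous_circle (fun=> 1 : C).
  by apply: continuous_subspaceT; exact: (@cst_continuous C^o C^o 1).
exists (fun=> 1).
  split; last by split=> [//|k _ t _].
  move=> n t; have [d0 _] := @fourier_unit R; split; first exact: d0.
  suff -> : derive1n n (fun s : R => complex.Im (1 : C)) = cst 0.
    exact: derivable_cst.
  elim: n => // n IH; rewrite derive1nS IH.
  by apply/funext => s; rewrite derive1_cst.
apply/funext => v; rewrite /toeplitz -[RHS]projH_id; congr (projH _).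
rewrite -[ell2_val v]reprK (mulL2_pi c1).
by congr (\pi_(L2 R) _)%qT; apply: val_inj; apply/funext => t; exact: mul1r.
Qed.

(** The rank-one operator [|v><e_0|]. *)
Definition ketbra v : operator R := fun x => coef x 0 *: v.

Lemma ketbra_bounded v : bounded_op (ketbra v).
Proof.
split=> [a x y|]; first by rewrite /ketbra coefD coefZ scalerDl scalerA.
exists (norm2 v) => x; rewrite [leLHS]normL2Z mulrC ler_wpM2l ?norm2_ge0 //.
exact: coef_le.
Qed.

(** The only nonzero column of the matrix is the one with index 0, holding the
    coefficients of [v]. *)
Lemma ketbra_KS v : schwartz v -> K_S (ketbra v).
Proof.
move=> sv; split; first exact: ketbra_bounded.
move=> alpha beta eps eps0; have [K hK] := sv alpha.+1.
have [m hm] : exists m : nat, K / eps < m%:R.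
  by exists (Num.truncn (K / eps)).+1; exact: truncnS_gt.
exists m => k n mkn; rewrite normrE ltcR !cabsM !cabs_natX.
rewrite -/(coef (ketbra v (e n)) k) /ketbra coefZ cabsM.
case: n mkn => [|n] mkn; last first.
  by rewrite /coef basis_inner cabs0 mul0r mulr0 mul0r.
have -> : coef (e 0) 0 = 1 by rewrite /coef basis_inner.
rewrite -[1 : C]/(1%:C) cabs_real normr1 mul1r.
have z1 : (0 : R) ^+ beta <= 1 by rewrite expr0n; case: eqP.
have k0 : 0 < k.+1%:R :> R by rewrite ltr0n.
have v0 := cabs_ge0 (coef v k).
apply: (@le_lt_trans _ _ (k%:R ^+ alpha * cabs (coef v k))).
  by rewrite ler_piMr // mulr_ge0.
apply: (@le_lt_trans _ _ (k.+1%:R ^+ alpha * cabs (coef v k))).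
  by rewrite ler_wpM2r // lerXn2r ?nnegrE // ler_nat.
rewrite -(ltr_pM2l k0) mulrA -exprS; apply: le_lt_trans (hK k) _.
rewrite -ltr_pdivrMr //; apply: lt_le_trans hm _.
by rewrite ler_nat; move: mkn; rewrite addn0; lia.
Qed.

Lemma ketbra_algA g v : schwartz v -> algA g (ketbra v).
Proof. by move=> sv; apply: Star_gen; left; exact: ketbra_KS. Qed.

End Algebra.

(** * The smooth domain of the Dirac operator *)

Section Dirac.
Context {R : realType} (S : operator R) (hS : is_shift S).
Local Notation C := R[i].
Local Notation ell2 := (ell2 R).
Local Notation e := (ebasis R).
Implicit Types (x y z v w : ell2).

Lemma coef_adjoint_shift x n : coef (adjoint S x) n = coef x n.+1.
Proof. by have [bS Se] := hS; rewrite /coef -adjointP // Se. Qed.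

Lemma coef_shiftS x n : coef (S x) n.+1 = coef x n.
Proof.
have [bS Se] := hS; rewrite /coef -ell2_innerJ adjointP // -[RHS]ell2_innerJ.
congr (conjc (inner_ell2 x _)); apply: coef_inj => k.
by rewrite coef_adjoint_shift /coef !basis_inner eqSS.
Qed.

Lemma coef_shift0 x : coef (S x) 0 = 0.
Proof.
have [bS Se] := hS; rewrite /coef -ell2_innerJ adjointP //.
have -> : adjoint S (e 0) = 0.
  apply: coef_inj => k.
  by rewrite coef_adjoint_shift /coef !basis_inner ell2_inner0r.
by rewrite ell2_inner0r conjc0.
Qed.

Lemma proj0E x : proj0 S x = coef x 0 *: e 0.
Proof.
apply: coef_inj => -[|k]; rewrite coefZ /proj0 /coef ell2_innerBr basis_inner.
  by rewrite -/(coef (S _) 0) coef_shift0 subr0 mulr1.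
by rewrite -/(coef (S _) k.+1) coef_shiftS coef_adjoint_shift subrr mulr0.
Qed.

Lemma schwartz_shift v : schwartz v -> schwartz (S v).
Proof.
move=> sv a; have [K K0 hK] := schwartz_ge0 a sv.
exists (2 ^+ a * K) => -[|k].
  by rewrite coef_shift0 cabs0 mulr0 mulr_ge0 // exprn_ge0.
rewrite coef_shiftS; apply: le_trans (ler_wpM2l _ (hK k)); last first.
  by rewrite exprn_ge0.
rewrite mulrA ler_wpM2r ?cabs_ge0 // -exprMn -natrM.
by rewrite lerXn2r ?nnegrE // ler_nat; lia.
Qed.

Lemma schwartz_adjoint_shift v : schwartz v -> schwartz (adjoint S v).
Proof.
move=> sv a; have [K hK] := sv a; exists K => k.
rewrite coef_adjoint_shift; apply: le_trans (hK k.+1).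
by rewrite ler_wpM2r ?cabs_ge0 // lerXn2r ?nnegrE // ler_nat.
Qed.

Lemma schwartz_number_sum v : schwartz v ->
  exists K, forall N,
    \sum_(n < N) n%:R ^+ 2 * normsq (coef v n) <= K :> R.
Proof.
move=> sv; have [K K0 hK] := schwartz_ge0 2 sv.
exists (K ^+ 2 * 2) => N.
apply: le_trans (ler_wpM2l (sqr_ge0 K) (sum_inv_sqr N)); rewrite mulr_sumr.
apply: ler_sum => n _; have n0 : 0 < n.+1%:R :> R by rewrite ltr0n.
rewrite ler_pdivlMr ?exprn_gt0 // -sqr_cabs.
apply: (@le_trans _ _ ((n.+1%:R ^+ 2 * cabs (coef v n)) ^+ 2)); last first.
  by rewrite ler_sqr ?nnegrE ?mulr_ge0 ?cabs_ge0 ?sqr_ge0.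
rewrite exprMn mulrAC ler_wpM2r ?sqr_ge0 // [leRHS]expr2 ler_wpM2r ?sqr_ge0 //.
by rewrite ler_sqr ?nnegrE // ler_nat.
Qed.

Lemma schwartz_dom v : schwartz v -> dom_number v.
Proof.
move=> /schwartz_number_sum[K hK]; apply: (@le_lt_trans _ _ K%:E); last exact: ltry.
apply: lime_le.
  apply: is_cvg_nneseries => n _ _.
  by rewrite lee_fin mulr_ge0 ?sqr_ge0 ?normsq_ge0.
by apply: nearW => N; rewrite sumEFin lee_fin big_mkord; exact: hK.
Qed.

Lemma schwartz_number v : schwartz v -> exists2 w, number_op v w & schwartz w.
Proof.
move=> sv; have [K hK] := schwartz_number_sum sv.
have [|w hw] := @coef_surj R (fun n => n%:R * coef v n) K.
  move=> N; apply: le_trans (hK N); rewrite le_eqVlt; apply/orP; left.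
  apply/eqP; apply: eq_bigr => n _; rewrite normsqM; congr (_ * _).
  by rewrite -sqr_cabs -[n%:R]expr1 cabs_natX.
exists w; first by split; [exact: schwartz_dom|exact: hw].
move=> a; have [L hL] := sv a.+1; exists L => k.
rewrite hw cabsM -[X in cabs X * _]expr1 cabs_natX expr1.
apply: le_trans (hL k); rewrite mulrA exprSr.
by rewrite ler_wpM2r ?cabs_ge0 // ler_wpM2l // ler_nat.
Qed.

Lemma dirac_schwartz (v : hilb R) : schwartz v.1 -> schwartz v.2 ->
  exists2 w : hilb R, dirac_op S v w & schwartz w.1 /\ schwartz w.2.
Proof.
move=> s1 s2; have [x hx sx] := schwartz_number s2.
have [y hy sy] := schwartz_number (schwartz_shift s1).
exists (adjoint S x, y); last by split=> //; exact: schwartz_adjoint_shift.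
by split=> //=; [exact: schwartz_dom|exact: schwartz_dom|exists x].
Qed.

Lemma dirac_coef (v w : hilb R) : dirac_op S v w -> forall n,
  coef w.1 n = n.+1%:R * coef v.2 n.+1 /\ coef w.2 n.+1 = n.+1%:R * coef v.1 n.
Proof.
move=> [_ _ [x [_ hx] w1] [_ hw2]] n; split.
  by rewrite w1 coef_adjoint_shift; exact: hx.
by rewrite -(coef_shiftS v.1); exact: hw2.
Qed.

(** Each application of the Dirac operator multiplies the coefficients by their
    index, up to a shift by one, and the coefficients of the final vector are
    bounded by its norm: [n] applications give decay of order [n]. *)
Lemma graph_pow_decay n (v w : hilb R) : graph_pow (dirac_op S) n v w ->
  exists K, forall k : nat, k.+1%:R ^+ n * cabs (coef v.1 k) <= K /\
                            k.+1%:R ^+ n * cabs (coef v.2 k) <= K.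
Proof.
elim: n v => [|n IH] v /=.
  move=> _; exists (norm2 v.1 + norm2 v.2) => k; rewrite expr0 !mul1r.
  by split; apply: le_trans (coef_le _ k) _; rewrite ?lerDl ?lerDr norm2_ge0.
move=> [u /dirac_coef Dvu /IH[K hK]].
have K0 : 0 <= K.
  by have [h _] := hK 0%N; rewrite (le_trans _ h) // mulr_ge0 ?cabs_ge0.
have cabsZ (k : nat) (z : C) : cabs (k%:R * z) = k%:R * cabs z.
  by rewrite cabsM -[X in cabs X * _]expr1 cabs_natX expr1.
exists (norm2 v.2 + (2 ^+ n.+1 + 1) * K) => k; split.
  have [_ Dk] := Dvu k; have [_ h] := hK k.+1.
  rewrite Dk cabsZ in h.
  apply: (@le_trans _ _ K); last first.
    have := norm2_ge0 v.2; have : 0 <= 2 ^+ n.+1 * K by rewrite mulr_ge0.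
    by lra.
  apply: le_trans h; rewrite exprSr -mulrA ler_wpM2r ?mulr_ge0 ?cabs_ge0 //.
  by rewrite lerXn2r ?nnegrE // ler_nat.
(* The lower component loses its coefficient of index 0 under the operator; the
   norm bounds it. Elsewhere the index drops by one, at the cost of a factor
   [2^(n+1)] because [k + 2 <= 2 (k + 1)]. *)
case: k => [|k].
  rewrite expr1n mul1r; apply: le_trans (coef_le _ _) _.
  by rewrite lerDl mulr_ge0 // addr_ge0 // exprn_ge0.
have [Dk _] := Dvu k; have [h _] := hK k.
rewrite Dk cabsZ in h.
apply: (@le_trans _ _ (2 ^+ n.+1 * K)); last first.
  by have := norm2_ge0 v.2; lra.
apply: le_trans (ler_wpM2l _ h); last by rewrite exprn_ge0.
rewrite !mulrA ler_wpM2r ?cabs_ge0 // -mulrA -exprSr -exprMn -natrM.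
by rewrite lerXn2r ?nnegrE // ler_nat; lia.
Qed.

Lemma H_inftyP (v : hilb R) :
  H_infty S v <-> schwartz v.1 /\ schwartz v.2.
Proof.
split=> [hv|[s1 s2] n].
  by split=> a; have [w /graph_pow_decay[K hK]] := hv a; exists K => k;
     have [] := hK k.
elim: n v s1 s2 => [|n IH] v s1 s2; first by exists v.
have [u Du [u1 u2]] := dirac_schwartz s1 s2.
by have [w hw] := IH u u1 u2; exists w, u.
Qed.

(** * The module isomorphism *)

(** Since [1 - S S^*] is [|e_0><e_0|], multiplying it by [a] gives
    [|a e_0><e_0|], and [a e_0] decays rapidly; conversely [|v><e_0|] is itself in
    the algebra when [v] decays rapidly. *)
Lemma cyclic_moduleP g (a : operator R) : cyclic_module g S a <->
  exists2 v, schwartz v & a = ketbra v.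
Proof.
have [bS Se] := hS; split=> [[b hb <-]|[v sv ->]].
  have [[lb _] pb _] := algA_smooth hb.
  exists (b (e 0)).
    apply: pb => n; exists 1 => k; rewrite /coef basis_inner.
    case: eqP => [->|_]; last by rewrite cabs0 mulr0.
    by rewrite expr1n mul1r -[1%:R : C]/(1%:C) cabs_real normr1.
  by apply/funext => x; rewrite /= proj0E linear_opZ.
exists (ketbra v); first exact: ketbra_algA.
apply/funext => x; rewrite /= proj0E /ketbra coefZ.
by rewrite [coef (e 0) 0]basis_inner mulr1.
Qed.

Lemma ketbra_e0 v : ketbra v (e 0) = v.
Proof. by rewrite /ketbra [coef _ _]basis_inner scale1r. Qed.

Lemma ketbraD v w : ketbra (v + w) = ketbra v + ketbra w.
Proof. by apply/funext => x; exact: scalerDr. Qed.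

Lemma ketbra_comp (a : operator R) v : linear a -> a \o ketbra v = ketbra (a v).
Proof. by move=> la; apply/funext => x; rewrite /= /ketbra linear_opZ. Qed.

Lemma mod_form_ketbra v (a : operator R) :
  mod_form (ketbra v) a = inner_ell2 v (a (e 0)).
Proof. by rewrite /mod_form /= -(adjointP (ketbra_bounded v)) ketbra_e0. Qed.

End Dirac.

Theorem proposition3p7 (R : realType) (g : nat) (S : operator R) (hS : is_shift S) :
  let A : set (operator R) := algA g in
  let M : set (operator R) := cyclic_module g S in
  [/\ left_module A (@act1 R) M /\ finitely_generated A (@act1 R) M,
      forall b a, M b -> M a ->
        mod_form b a = inner_ell2 (b (ebasis R 0)) (a (ebasis R 0)),
      left_module A (@repH R) (H_infty S),
      left_module A (@act2 R) (M `*` M)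
    & isometrically_isomorphic A
        (@repH R) (@innerH R) (H_infty S)
        (@act2 R) (@mod_form2 R) (M `*` M)].
Proof.
move=> A M.
have lin a : A a -> linear a by move=> /algA_smooth[[]].
have pres a v : A a -> schwartz v -> schwartz (a v).
  by move=> /algA_smooth[_ pa _]; exact: pa.
have ME a : M a <-> exists2 v, schwartz v & a = ketbra v by exact: cyclic_moduleP.
have Mk v : schwartz v -> M (ketbra v) by move=> sv; apply/ME; exists v.
have M0 : M 0.
  have -> : (0 : operator R) = ketbra 0 by apply/funext => x; rewrite /ketbra scaler0.
  exact/Mk/schwartz0.
have MD a b : M a -> M b -> M (a + b).
  move=> /ME[v sv ->] /ME[w sw ->]; rewrite -ketbraD.
  exact/Mk/schwartzD.
have Mact a b : A a -> M b -> M (a \o b).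
  move=> Aa /ME[v sv ->]; rewrite ketbra_comp; last exact: lin.
  exact/Mk/pres.
have actD a b c : A a -> a \o (b + c : operator R) = (a \o b : operator R) + (a \o c).
  by move=> Aa; apply/funext => x; rewrite /= -[LHS]/(a (b x + c x)) linear_opD //; exact: lin.
split.
- split; first by split=> //; move=> a v w Aa _ _; exact: actD.
  exists 1%N, (fun=> proj0 S); split=> [_|v [a Aa <-]].
    by exists id; [exact: algA_id|].
  by exists (fun=> a); split=> //; rewrite big_ord1.
- by move=> b a /ME[v _ ->] _; rewrite mod_form_ketbra ketbra_e0.
- split.
  + split; first by apply/(H_inftyP hS); split; exact: schwartz0.
    move=> v w /(H_inftyP hS)[? ?] /(H_inftyP hS)[? ?]; apply/(H_inftyP hS).
    by split; exact: schwartzD.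
  + move=> a v Aa /(H_inftyP hS)[? ?]; apply/(H_inftyP hS).
    by split; exact: pres.
  + by move=> a v w Aa _ _; rewrite /repH /= !linear_opD //; exact: lin.
  + by [].
  + by [].
- split.
  + by split=> [//|v w [? ?] [? ?]]; split; exact: MD.
  + by move=> a v Aa [? ?]; split; exact: Mact.
  + by move=> a v w Aa _ _; congr pair; exact: actD.
  + by [].
  + by [].
(* The isomorphism sends [v] to [|v><e_0|] in each component; evaluation at [e_0]
   inverts it. *)
exists (fun v => (ketbra v.1, ketbra v.2)); split.
- split.
  + by move=> v /(H_inftyP hS)[? ?]; split; exact: Mk.
  + have at0 v w : ketbra v = ketbra w -> v = w.
      by move=> vw; rewrite -[v]ketbra_e0 vw ketbra_e0.
    by move=> [v1 v2] [w1 w2] _ _ [/at0 -> /at0 ->].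
  + move=> [a b] [/= /ME[v sv ->] /ME[w sw ->]]; exists (v, w) => //.
    exact/(H_inftyP hS).
- by move=> v w _ _; congr pair; exact: ketbraD.
- by move=> a v Aa _; congr pair; rewrite /= ketbra_comp //; exact: lin.
- by move=> v w _ _; rewrite /mod_form2 /= !mod_form_ketbra !ketbra_e0.
Qed.
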